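(* Let $m\ge 1$ and $1\le p<\infty$. Then $(E^{m,p}, d_p)$ is the completion of $(E^{m}, d_p)$.
   Context: $H$ is the Hausdorff metric on nonempty closed subsets of $\mathbb{R}^m$ (Euclidean distance): $H(A,B)=\max\{\sup_{a\in A}\inf_{b\in B}d(a,b),\ \sup_{b\in B}\inf_{a\in A}d(a,b)\}$ (possibly $+\infty$). A fuzzy set on $\mathbb{R}^m$ is a function $u:\mathbb{R}^m\to[0,1]$; its cuts are $[u]_\alpha=\{x: u(x)\ge\alpha\}$ for $\alpha\in(0,1]$ and $[u]_0=\overline{\{x: u(x)>0\}}$. $E^{m}$ (fuzzy numbers) is the set of fuzzy sets $u$ that are normal ($u(x_0)=1$ for some $x_0$), upper semi-continuous, have $[u]_0$ bounded, and are fuzzy convex: $u(\lambda x+(1-\lambda)y)\ge\min\{u(x),u(y)\}$ for all $x,y\in\mathbb{R}^m$ and $\lambda\in[0,1]$. $E^{m,p}$ is defined in the same way, with the condition ''$[u]_0$ bounded'' replaced by $\left(\int_0^1 H([u]_\alpha,\{0\})^p\,d\alpha\right)^{1/p}<+\infty$, where $0$ is the origin; so $E^m\subset E^{m,p}$. The metric on both is $d_p(u,v)=\left(\int_0^1 H([u]_\alpha,[v]_\alpha)^p\,d\alpha\right)^{1/p}$. A metric space $Y$ is the completion of a subspace $X\subset Y$ if $Y$ is complete and $X$ is dense in $Y$. *)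

(* Defs.v *)
From mathcomp Require Import all_boot all_order all_algebra.
From mathcomp Require Import all_classical all_reals all_analysis.
Set Implicit Arguments.
Unset Strict Implicit.
Unset Printing Implicit Defensive.
Import Order.TTheory GRing.Theory Num.Theory.
Import numFieldNormedType.Exports.
Local Open Scope classical_set_scope.
Local Open Scope ring_scope.

(* The norm of ['rV[R]_m] is the sup norm, hence the explicit Euclidean
   distance; both induce the same topology and the same bounded sets, so
   [closure], [\near] and [bounded_set] below are the usual ones. *)
Definition eucl_dist (R : realType) (m : nat) (x y : 'rV[R]_m) : R :=
  Num.sqrt (\sum_(i < m) (x ord0 i - y ord0 i) ^+ 2).

Definition hausdorff_dist (R : realType) (m : nat) (A B : set 'rV[R]_m) :
    \bar R :=
  Order.max
    (ereal_sup [set ereal_inf [set (eucl_dist a b)%:E | b in B] | a in A])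
    (ereal_sup [set ereal_inf [set (eucl_dist a b)%:E | a in A] | b in B]).

Definition fuzzy_set (R : realType) (m : nat) (u : 'rV[R]_m -> R) : Prop :=
  forall x, 0 <= u x <= 1.

(* Only meaningful for [alpha] in [0, 1]. *)
Definition fuzzy_cut (R : realType) (m : nat) (u : 'rV[R]_m -> R) (alpha : R) :
    set 'rV[R]_m :=
  if alpha == 0 then closure [set x | 0 < u x] else [set x | alpha <= u x].

Definition normal_fuzzy (R : realType) (m : nat) (u : 'rV[R]_m -> R) : Prop :=
  exists x0, u x0 = 1.

Definition upper_semicontinuous (R : realType) (X : topologicalType)
    (f : X -> R) : Prop :=
  forall x a, f x < a -> \forall y \near x, f y < a.

Definition fuzzy_convex (R : realType) (m : nat) (u : 'rV[R]_m -> R) : Prop :=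
  forall (x y : 'rV[R]_m) (l : R), 0 <= l <= 1 ->
    Num.min (u x) (u y) <= u (l *: x + (1 - l) *: y).

Definition fuzzy_number (R : realType) (m : nat) : set ('rV[R]_m -> R) :=
  [set u | [/\ fuzzy_set u, normal_fuzzy u, upper_semicontinuous u,
               fuzzy_convex u & bounded_set (fuzzy_cut u 0)]].

(* ([poweR], written [`^] in [ereal_scope], satisfies [+oo `^ r = +oo] for
   [r != 0].) *)
Definition Lp_fuzzy_number (R : realType) (m : nat) (p : R) :
    set ('rV[R]_m -> R) :=
  [set u | [/\ fuzzy_set u, normal_fuzzy u, upper_semicontinuous u,
               fuzzy_convex u &
      ((\int[lebesgue_measure]_(alpha in `[0%R, 1%R]%classic)
          hausdorff_dist (fuzzy_cut u alpha) [set 0%R] `^ p) `^ p^-1 < +oo)%E]].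

Definition dp (R : realType) (m : nat) (p : R) (u v : 'rV[R]_m -> R) :
    \bar R :=
  ((\int[lebesgue_measure]_(alpha in `[0%R, 1%R]%classic)
      hausdorff_dist (fuzzy_cut u alpha) (fuzzy_cut v alpha) `^ p) `^ p^-1)%E.

(* [(Y, d)] is a metric space and is the completion of its subspace [X].
   Since library metric spaces are types with a real-valued distance, [(Y, d)]
   is presented by a [metricType] [M] with an isometric bijection [f] onto [Y];
   in particular [d] is finite and satisfies the metric axioms on [Y]. *)
Definition is_completion (R : realType) (T : Type) (d : T -> T -> \bar R)
    (Y X : set T) : Prop :=
  X `<=` Y /\
  exists (M : metricType R) (f : M -> T),
    [/\ set_bij [set: M] Y f,
        forall x y : M, (mdist x y)%:E = d (f x) (f y),
        forall F : set_system M, ProperFilter F -> cauchy F ->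
          exists l : M, F --> l
      & dense (f @^-1` X)].

(* Main.v *)
(* For [alpha > 0] the cuts of an element of [E^{m,p}] are compact and
   left-continuous in [alpha], so that [alpha |-> H([u]_alpha, [v]_alpha)] is
   measurable, and Minkowski's inequality makes [d_p] a metric on [E^{m,p}].

   Density: cutting [u] off below a small height [c] gives a fuzzy number with
   the same cuts at all levels [>= c]; dominated convergence, with dominating
   function [(2 H([u]_alpha, {0}))^p], lets [c] tend to [0].

   Completeness: pass to a sequence with [d_p(u_k, u_{k+1}) <= 4^-k]. Then
   [sum_k (2^k H([u_k]_alpha, [u_{k+1}]_alpha))^p] has a finite integral, so for
   almost every [alpha] the cuts [[u_k]_alpha] converge geometrically to a
   nonempty compact convex set [K_alpha], at a rate whose [p]-th power is
   integrable. The function [u x = sup {alpha | x in K_alpha}] lies in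
   [E^{m,p}], and [[u]_alpha = K_alpha] outside a countable set of levels. *)
From HB Require Import structures.
Require Import Defs.
From mathcomp Require Import all_boot all_order all_algebra.
From mathcomp Require Import all_classical all_reals all_analysis.
From mathcomp Require Import measurable_realfun.
From mathcomp Require Import ring lra.
Set Implicit Arguments.
Unset Strict Implicit.
Unset Printing Implicit Defensive.
Import Order.TTheory GRing.Theory Num.Theory.
Import numFieldNormedType.Exports.
Local Open Scope classical_set_scope.
Local Open Scope ring_scope.

(** * Euclidean distance *)

Section EuclideanDistance.
Context {R : realType} {m : nat}.
Implicit Types (x y z : 'rV[R]_m) (A : set 'rV[R]_m).

Lemma eucl_dist_ge0 x y : 0 <= eucl_dist x y.
Proof. exact: sqrtr_ge0. Qed.

Lemma eucl_distxx x : eucl_dist x x = 0.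
Proof.
by rewrite /eucl_dist big1 ?sqrtr0// => i _; rewrite subrr expr0n.
Qed.

Lemma eucl_distC x y : eucl_dist x y = eucl_dist y x.
Proof.
rewrite /eucl_dist; congr Num.sqrt; apply: eq_bigr => i _.
by rewrite -sqrrN opprB.
Qed.

Lemma sqr_eucl_dist x y :
  eucl_dist x y ^+ 2 = \sum_(i < m) (x ord0 i - y ord0 i) ^+ 2.
Proof. by rewrite /eucl_dist sqr_sqrtr// sumr_ge0// => i _; exact: sqr_ge0. Qed.

(** Summing [0 <= (Q a_i - P b_i)^2] over [i] gives the claim multiplied by [2 P Q]. A zero [P] or
    [Q] forces its vector to vanish and is settled first. *)
Lemma cauchy_schwarz_sum (a b : 'I_m -> R) :
  \sum_i a i * b i <=
  Num.sqrt (\sum_i a i ^+ 2) * Num.sqrt (\sum_i b i ^+ 2).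
Proof.
have pos (c : 'I_m -> R) : 0 <= \sum_i c i ^+ 2.
  by rewrite sumr_ge0// => i _; exact: sqr_ge0.
set P := Num.sqrt _; set Q := Num.sqrt _.
have P2 : P ^+ 2 = \sum_i a i ^+ 2 by rewrite sqr_sqrtr.
have Q2 : Q ^+ 2 = \sum_i b i ^+ 2 by rewrite sqr_sqrtr.
have zero (c d : 'I_m -> R) : \sum_i c i ^+ 2 = 0 -> \sum_i c i * d i = 0.
  move=> /eqP; rewrite psumr_eq0 => [|i _]; last exact: sqr_ge0.
  move=> /allP c0; apply: big1 => i _.
  have := c0 i; rewrite mem_index_enum implyTb sqrf_eq0 => /(_ isT)/eqP ->.
  by rewrite mul0r.
have [P0|P0] := eqVneq P 0.
  by rewrite P0 mul0r zero// -P2 P0 expr0n.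
have [Q0|Q0] := eqVneq Q 0.
  under eq_bigr do rewrite mulrC.
  by rewrite Q0 mulr0 zero// -Q2 Q0 expr0n.
have PQ : 0 < P * Q by rewrite mulr_gt0// lt_def ?P0 ?Q0 sqrtr_ge0.
rewrite -(ler_pM2l PQ) -(@ler_pM2l _ 2)//.
have -> : 2 * (P * Q * (P * Q)) = Q ^+ 2 * P ^+ 2 + P ^+ 2 * Q ^+ 2 by ring.
rewrite {1}P2 {2}Q2 !mulr_sumr -big_split/=; apply: ler_sum => i _.
have := sqr_ge0 (Q * a i - P * b i); nra.
Qed.

Lemma eucl_dist_triangle y x z :
  eucl_dist x z <= eucl_dist x y + eucl_dist y z.
Proof.
rewrite -ler_sqr ?nnegrE ?addr_ge0 ?eucl_dist_ge0// sqrrD !sqr_eucl_dist.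
rewrite (_ : \sum_i _ = \sum_(i < m) (x ord0 i - y ord0 i) ^+ 2 +
  (\sum_(i < m) (x ord0 i - y ord0 i) * (y ord0 i - z ord0 i)) *+ 2 +
  \sum_(i < m) (y ord0 i - z ord0 i) ^+ 2); last first.
  by rewrite -sumrMnl -!big_split/=; apply: eq_bigr => i _; ring.
by rewrite lerD2r lerD2l lerMn2r/=; exact: cauchy_schwarz_sum.
Qed.

Lemma eucl_distZ (l : R) x y :
  eucl_dist (l *: x) (l *: y) = `|l| * eucl_dist x y.
Proof.
apply/eqP; rewrite -(@eqrXn2 _ 2)// ?mulr_ge0 ?eucl_dist_ge0//.
rewrite exprMn !sqr_eucl_dist mulr_sumr real_normK ?num_real//; apply/eqP.
by apply: eq_bigr => i _; rewrite !mxE -mulrBr exprMn.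
Qed.

Lemma eucl_distD2l z x y : eucl_dist (z + x) (z + y) = eucl_dist x y.
Proof.
rewrite /eucl_dist; congr Num.sqrt; apply: eq_bigr => i _.
by rewrite !mxE; congr (_ ^+ 2); ring.
Qed.

Lemma eucl_distD2r z x y : eucl_dist (x + z) (y + z) = eucl_dist x y.
Proof. by rewrite ![_ + z]addrC eucl_distD2l. Qed.

Lemma eucl_dist_convex (l r : R) x y x' y' : 0 <= l <= 1 ->
  eucl_dist x x' < r -> eucl_dist y y' < r ->
  eucl_dist (l *: x + (1 - l) *: y) (l *: x' + (1 - l) *: y') < r.
Proof.
move=> /andP[l0 l1] xr yr.
apply: le_lt_trans (eucl_dist_triangle (l *: x' + (1 - l) *: y) _ _) _.
rewrite eucl_distD2l eucl_distD2r !eucl_distZ !ger0_norm// ?subr_ge0//.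
(* For [l = 0] only the second distance supplies strictness; for [l > 0] the first one does. *)
have [->|ln0] := eqVneq l 0; first by rewrite mul0r add0r subr0 mul1r.
have {}l0 : 0 < l by rewrite lt_def ln0.
by nra.
Qed.

Lemma le_coord_eucl_dist x y i : `|x ord0 i - y ord0 i| <= eucl_dist x y.
Proof.
rewrite -ler_sqr ?nnegrE ?eucl_dist_ge0// real_normK ?num_real// sqr_eucl_dist.
by rewrite (bigD1 i)//= lerDl sumr_ge0// => j _; exact: sqr_ge0.
Qed.

Lemma norm_le_eucl_dist x y : `|x - y| <= eucl_dist x y.
Proof.
rewrite [leLHS]/Num.norm/= mx_normrE; apply/bigmax_leP; split.
  exact: eucl_dist_ge0.
by move=> [i j] _ /=; rewrite !mxE (ord1 i); exact: le_coord_eucl_dist.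
Qed.

(** A crude factor ([sqrt m] would be sharp), but enough to transfer neighbourhoods and boundedness
    between the two distances. *)
Lemma eucl_dist_le_norm x y : eucl_dist x y <= m%:R * `|x - y|.
Proof.
rewrite -ler_sqr ?nnegrE ?eucl_dist_ge0 ?mulr_ge0// sqr_eucl_dist.
apply: (@le_trans _ _ (\sum_(i < m) `|x - y| ^+ 2)).
  apply: ler_sum => i _; rewrite -(real_normK (num_real (_ - _)))//.
  rewrite ler_sqr ?nnegrE//.
  have := @le_bigmax _ _ _ 0 (fun i : 'I_1 * 'I_m => `|(x - y) i.1 i.2|) (ord0, i).
  by rewrite [X in _ -> _ <= X]/Num.norm/= mx_normrE/= !mxE.
rewrite sumr_const card_ord -[leLHS]mulr_natl exprMn ler_wpM2r ?sqr_ge0//.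
case: (m) => [|n]; first by rewrite expr0n.
by rewrite expr2 ler_peMr// ler1n.
Qed.

Lemma bounded_euclP A :
  bounded_set A <-> exists M, forall x, A x -> eucl_dist x 0 <= M.
Proof.
split=> [[M [_ AM]]|[M AM]].
  exists (m%:R * (M + 1)) => x Ax; apply: (le_trans (eucl_dist_le_norm _ _)).
  by rewrite subr0 ler_wpM2l// AM// ltrDl.
exists M; split; first exact: num_real.
move=> N MN x Ax; rewrite -(subr0 x).
exact: le_trans (norm_le_eucl_dist _ _) (le_trans (AM _ Ax) (ltW MN)).
Qed.

Lemma near_eucl_dist x (e : R) : 0 < e -> \forall y \near x, eucl_dist x y < e.
Proof.
move=> e0; have m0 : 0 < m%:R + 1 :> R by rewrite ltr_wpDl.
apply/nbhs_ballP; exists (e / (m%:R + 1)) => /=; first by rewrite divr_gt0.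
move=> y; rewrite mx_norm_ball /ball_/= ltr_pdivlMr// => xy.
apply: le_lt_trans (eucl_dist_le_norm _ _) _; apply: le_lt_trans xy.
by rewrite mulrC ler_wpM2l// lerDl.
Qed.

End EuclideanDistance.

(** * Hausdorff distance *)

Section HausdorffDistance.
Context {R : realType} {m : nat}.
Implicit Types (A B C : set 'rV[R]_m) (r s : R).

Lemma ereal_inf_image_leP (T : Type) (B : set T) (f : T -> R) r :
  (ereal_inf [set (f b)%:E | b in B] <= r%:E)%E <->
  forall e, 0 < e -> exists2 b, B b & f b < r + e.
Proof.
split=> [Br e e0|Br].
  have : (ereal_inf [set (f b)%:E | b in B] < (r + e)%:E)%E.
    by apply: le_lt_trans Br _; rewrite lte_fin ltrDl.
  by move=> /ereal_inf_lt[_ [b Bb <-]]; rewrite lte_fin => fb; exists b.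
apply/lee_addgt0Pr => e e0; have [b Bb fb] := Br _ e0.
apply: (@le_trans _ _ (f b)%:E); first by apply: ereal_inf_lbound; exists b.
by rewrite lee_fin ltW.
Qed.

(** The infima need not be attained, hence the slack [e]. In this form later estimates compare
    points instead of suprema of infima. *)
Lemma hausdorff_dist_leP A B r : (hausdorff_dist A B <= r%:E)%E <->
  (forall a e, A a -> 0 < e -> exists2 b, B b & eucl_dist a b < r + e) /\
  (forall b e, B b -> 0 < e -> exists2 a, A a & eucl_dist a b < r + e).
Proof.
rewrite /hausdorff_dist ge_max; split=> [/andP[AB BA]|[AB BA]].
  split=> [a e Aa|b e Bb].
    move: e; apply/(ereal_inf_image_leP B (eucl_dist a)).
    by apply: le_trans AB; apply: ereal_sup_ubound; exists a.
  have /ereal_inf_image_leP/(_ e)// :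
    (ereal_inf [set (eucl_dist a b)%:E | a in A] <= r%:E)%E.
  by apply: le_trans BA; apply: ereal_sup_ubound; exists b.
apply/andP; split; apply: ge_ereal_sup => _ [c Ac <-].
  by apply/ereal_inf_image_leP => e e0; exact: AB.
by apply/ereal_inf_image_leP => e e0; exact: BA.
Qed.

Lemma hausdorff_distC A B : hausdorff_dist A B = hausdorff_dist B A.
Proof.
rewrite /hausdorff_dist maxC.
by congr Order.max; congr ereal_sup; apply: eq_imagel => a _;
  congr ereal_inf; apply: eq_imagel => b _; rewrite eucl_distC.
Qed.

(** For two empty sets both suprema would be [-oo]. *)
Lemma hausdorff_dist_ge0 A B : A !=set0 -> (0 <= hausdorff_dist A B)%E.
Proof.
move=> [a Aa]; rewrite /hausdorff_dist le_max; apply/orP; left.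
apply: (@le_trans _ _ (ereal_inf [set (eucl_dist a b)%:E | b in B])).
  by apply: le_ereal_inf_tmp => _ [b _ <-]; rewrite lee_fin eucl_dist_ge0.
by apply: ereal_sup_ubound; exists a.
Qed.

Lemma hausdorff_distxx A : A !=set0 -> hausdorff_dist A A = 0%E.
Proof.
move=> A0; apply/eqP; rewrite eq_le hausdorff_dist_ge0// andbT.
by apply/hausdorff_dist_leP; split=> a e Aa e0; exists a => //;
  rewrite eucl_distxx add0r.
Qed.

Lemma hausdorff_dist_triangle B A C : A !=set0 -> B !=set0 ->
  (hausdorff_dist A C <= hausdorff_dist A B + hausdorff_dist B C)%E.
Proof.
move=> A0 B0.
have := hausdorff_dist_ge0 B A0; have := hausdorff_dist_ge0 C B0.
(* Infinite distances come first: nonnegativity excludes [-oo], so the sum on the right is then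
   [+oo]. *)
case BC : (hausdorff_dist B C) => [s| |] // _ AB0; last first.
  by rewrite addey ?leey// -ltNye (lt_le_trans _ AB0).
move: AB0; case AB : (hausdorff_dist A B) => [r| |] // _; last by rewrite addye ?leey.
have /hausdorff_dist_leP[AB1 AB2] : (hausdorff_dist A B <= r%:E)%E by rewrite AB.
have /hausdorff_dist_leP[BC1 BC2] : (hausdorff_dist B C <= s%:E)%E by rewrite BC.
rewrite -EFinD; apply/hausdorff_dist_leP; split=> a e Aa e0.
  have e20 : 0 < e / 2 by rewrite divr_gt0.
  have [b Bb ab] := AB1 _ _ Aa e20; have [c Cc bc] := BC1 _ _ Bb e20.
  by exists c => //; apply: le_lt_trans (eucl_dist_triangle b _ _) _; lra.
have e20 : 0 < e / 2 by rewrite divr_gt0.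
have [b Bb ab] := BC2 _ _ Aa e20; have [c Cc bc] := AB2 _ _ Bb e20.
by exists c => //; apply: le_lt_trans (eucl_dist_triangle b _ _) _; lra.
Qed.

Lemma hausdorff_dist0_leP A r : A !=set0 ->
  (hausdorff_dist A [set 0%R] <= r%:E)%E <->
  forall a, A a -> eucl_dist a 0 <= r.
Proof.
move=> [a0 Aa0]; split=> [/hausdorff_dist_leP[+ _] a Aa|Ar].
  by move=> A0; apply/ler_addgt0Pl => e e0; have [_ ->] := A0 _ _ Aa e0;
    rewrite addrC => /ltW.
apply/hausdorff_dist_leP; split=> [a e Aa e0|_ e -> e0].
  by exists 0 => //; rewrite (le_lt_trans (Ar _ Aa))// ltrDl.
by exists a0 => //; rewrite (le_lt_trans (Ar _ Aa0))// ltrDl.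
Qed.

Lemma bounded_hausdorff_dist0 A : A !=set0 ->
  bounded_set A <-> (hausdorff_dist A [set 0%R] < +oo)%E.
Proof.
move=> A0; split=> [/bounded_euclP[M AM]|].
  by apply: (@le_lt_trans _ _ M%:E); [exact/hausdorff_dist0_leP|rewrite ltry].
have := hausdorff_dist_ge0 [set 0%R] A0.
case AM : hausdorff_dist => [M| |]// _ _.
apply/bounded_euclP; exists M; apply/hausdorff_dist0_leP => //.
by rewrite AM.
Qed.

(** Triangle inequality through [[set 0]]. *)
Lemma hausdorff_dist_fin_num A B : A !=set0 -> B !=set0 ->
  bounded_set A -> bounded_set B -> hausdorff_dist A B \is a fin_num.
Proof.
move=> A0 B0 /(bounded_hausdorff_dist0 A0) Ab /(bounded_hausdorff_dist0 B0) Bb.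
rewrite ge0_fin_numE ?hausdorff_dist_ge0//.
apply: le_lt_trans (@hausdorff_dist_triangle [set 0] _ _ A0 _) _; first by exists 0.
by rewrite lte_add_pinfty// hausdorff_distC.
Qed.

(** At distance [0] every point of one set lies in the closure of the other; by symmetry one
    inclusion is enough. *)
Lemma hausdorff_dist_eq0 A B : closed A -> closed B ->
  hausdorff_dist A B = 0%E -> A = B.
Proof.
wlog suff : A B / closed B -> (hausdorff_dist A B <= 0%:E)%E -> A `<=` B.
  move=> sub cA cB AB; apply/seteqP.
  by split; apply: sub => //; rewrite ?AB// hausdorff_distC AB.
move=> cB /hausdorff_dist_leP[AB _] a Aa; apply: cB => U.
move=> /nbhs_ballP[e /= e0 eU]; have [b Bb ab] := AB _ _ Aa e0.
exists b; split=> //; apply: eU; rewrite mx_norm_ball /ball_/=.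
by rewrite (le_lt_trans (norm_le_eucl_dist _ _))//; rewrite add0r in ab.
Qed.

End HausdorffDistance.

(** * Cuts at positive levels *)

Section BoundedCuts.
Context {R : realType} {m : nat}.
Implicit Types (u v w : 'rV[R]_m -> R) (r : R).

(** The working class, independent of [p]: it contains both spaces. Its cuts at positive levels are
    compact, while the support may be unbounded. *)
Definition bounded_cut_fuzzy u :=
  [/\ fuzzy_set u, normal_fuzzy u, upper_semicontinuous u, fuzzy_convex u &
      forall a, 0 < a -> bounded_set [set x | a <= u x]].

Lemma fuzzy_cut_gt0 u a : 0 < a -> fuzzy_cut u a = [set x | a <= u x].
Proof. by rewrite /fuzzy_cut => /gt_eqF ->. Qed.

Lemma fuzzy_cut_nonempty u a : normal_fuzzy u -> 0 <= a <= 1 ->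
  fuzzy_cut u a !=set0.
Proof.
move=> [x ux1] /andP[a0 a1]; exists x; rewrite /fuzzy_cut; case: ifPn => _ /=.
  by apply: subset_closure => /=; rewrite ux1.
by rewrite ux1.
Qed.

Lemma closed_cut u a : upper_semicontinuous u -> closed [set x | a <= u x].
Proof.
move=> uu x clx /=; rewrite leNgt; apply/negP => /uu /clx[y [/= ay]].
by rewrite ltNge ay.
Qed.

(** Left continuity of the cuts, by compactness: points chosen at levels increasing to [a] stay in
    the compact cut at [a / 2], and a cluster point of them is the point sought. It serves for
    measurability and for the normality of the limit. *)
Lemma cut_left_limit u x (c a : R) : upper_semicontinuous u ->
  (forall b, 0 < b -> bounded_set [set y | b <= u y]) -> 0 < a ->
  (forall q e, 0 < q < a -> 0 < e -> exists2 y, q <= u y & eucl_dist x y <= c + e) ->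
  exists2 y, a <= u y & eucl_dist x y <= c.
Proof.
move=> uu bu a0 H.
have a2 : 0 < a / 2 by rewrite divr_gt0.
(* The levels [q k] start at [a / 2] and increase to [a]. *)
pose q k : R := a - (a / 2) / k.+1%:R; pose e k : R := k.+1%:R^-1.
have qlt k : a / 2 <= q k < a.
  rewrite /q ltrBlDr ltrDl divr_gt0// andbT lerBrDr.
  rewrite [leRHS](splitr a) lerD2l ler_pdivrMr// ler_peMr ?ler1n//.
  exact: ltW.
have /choice[y yP] : forall k, exists y, q k <= u y /\ eucl_dist x y <= c + e k.
  move=> k; have [|//|y qy xy] := H (q k) (e k); last by exists y.
    by have /andP[q1 ->] := qlt k; rewrite (lt_le_trans a2 q1).
  by rewrite /e invr_gt0.
have cpt := bounded_closed_compact (bu _ a2) (closed_cut (a := a / 2) uu).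
have [|z [_ yz]] := cpt (y @ \oo) _.
  exists 0%N => // k _ /=; have [+ _] := yP k; apply: le_trans.
  by have /andP[] := qlt k.
have near_inv (d : R) : 0 < d -> \forall k \near \oo, k.+1%:R^-1 < d.
  by move=> d0; exact: (near_infty_natSinv_lt (PosNum d0)).
exists z.
  (* If [u z < a], upper semicontinuity keeps [u] below the midpoint [b] near [z], whereas
     [u (y k) >= q k >= b] for large [k]. *)
  rewrite leNgt; apply/negP => uza; pose b := (u z + a) / 2.
  have ub : u z < b by rewrite /b; lra.
  have ba : b < a by rewrite /b; lra.
  have ev : (y @ \oo) [set t | b <= u t].
    have d0 : 0 < (a - b) / (a / 2) by rewrite divr_gt0// subr_gt0.
    rewrite nbhs_simpl/=; near=> k; have [+ _] := yP k; apply: le_trans; rewrite /q.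
    have /ltW : k.+1%:R^-1 < (a - b) / (a / 2) by near: k; exact: near_inv.
    by rewrite ler_pdivlMr// mulrC => H1; rewrite lerBrDr addrC -lerBrDr.
  have [t [/= bt]] := yz _ _ ev (uu _ _ ub).
  by rewrite ltNge bt.
apply/ler_addgt0Pl => d d0.
have d20 : 0 < d / 2 by rewrite divr_gt0.
have ev : (y @ \oo) [set t | eucl_dist x t <= c + d / 2].
  rewrite nbhs_simpl/=; near=> k; have [_ +] := yP k; move/le_trans; apply.
  by rewrite lerD2l; apply: ltW; near: k; exact: near_inv.
have [t [/= xt zt]] := yz _ _ ev (near_eucl_dist z d20).
apply: le_trans (eucl_dist_triangle t _ _) _.
by rewrite (eucl_distC t) ; lra.
Unshelve. all: by end_near. Qed.

(* The level [0] is negligible; at positive levels the distance is finite for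
   bounded cuts, so that [fine] loses nothing there. *)
Definition cut_dist u v (a : R) : R :=
  if 0 < a <= 1 then fine (hausdorff_dist (fuzzy_cut u a) (fuzzy_cut v a)) else 0.

Lemma cut_distE u v a : bounded_cut_fuzzy u -> bounded_cut_fuzzy v ->
  0 < a <= 1 ->
  (cut_dist u v a)%:E = hausdorff_dist (fuzzy_cut u a) (fuzzy_cut v a).
Proof.
move=> [_ nu _ _ bu] [_ nv _ _ bv] /andP[a0 a1].
rewrite /cut_dist a0 a1/= fineK// hausdorff_dist_fin_num//.
- by apply: fuzzy_cut_nonempty; rewrite ?(ltW a0).
- by apply: fuzzy_cut_nonempty; rewrite ?(ltW a0).
- by rewrite fuzzy_cut_gt0//; exact: bu.
- by rewrite fuzzy_cut_gt0//; exact: bv.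
Qed.

Lemma cut_dist_leP u v a r : bounded_cut_fuzzy u -> bounded_cut_fuzzy v ->
  0 < a <= 1 ->
  cut_dist u v a <= r <->
  (forall x e, a <= u x -> 0 < e -> exists2 y, a <= v y & eucl_dist x y < r + e) /\
  (forall y e, a <= v y -> 0 < e -> exists2 x, a <= u x & eucl_dist x y < r + e).
Proof.
move=> bu bv a01; rewrite -lee_fin cut_distE// hausdorff_dist_leP.
by have /andP[a0 _] := a01; rewrite !fuzzy_cut_gt0.
Qed.

Lemma cut_dist_ge0 u v a : bounded_cut_fuzzy u -> 0 <= cut_dist u v a.
Proof.
move=> [_ nu _ _ _]; rewrite /cut_dist; case: ifPn => // /andP[a0 a1].
rewrite fine_ge0// hausdorff_dist_ge0//.
by apply: fuzzy_cut_nonempty; rewrite ?(ltW a0).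
Qed.

Lemma cut_distC u v a : cut_dist u v a = cut_dist v u a.
Proof. by rewrite /cut_dist hausdorff_distC. Qed.

Lemma cut_dist_triangle v u w a : bounded_cut_fuzzy u -> bounded_cut_fuzzy v ->
  bounded_cut_fuzzy w -> cut_dist u w a <= cut_dist u v a + cut_dist v w a.
Proof.
move=> bu bv bw; have [a01|a01] := boolP (0 < a <= 1); last first.
  by rewrite /cut_dist (negPf a01) addr0.
rewrite -lee_fin EFinD !cut_distE//.
have /andP[a0 a1] := a01.
by apply: hausdorff_dist_triangle; apply: fuzzy_cut_nonempty;
  rewrite ?(ltW a0)//; [case: bu|case: bv].
Qed.

(* By left continuity of the cuts of [v], the level may be replaced by a smaller
   rational one on the side of [v] only; for a fixed rational, the set of levels
   is an interval because the cuts of [u] decrease. *)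
Lemma measurable_far_levels u v r : bounded_cut_fuzzy v ->
  measurable [set a | 0 < a <= 1 /\ exists x e, [/\ a <= u x, 0 < e &
    forall y, a <= v y -> r + e <= eucl_dist x y]].
Proof.
move=> [_ _ uv _ bv].
pose T (q : rat) : set R :=
  [set a : R | [/\ 0 < ratr q :> R, ratr q <= a & a <= 1] /\
  exists x e, [/\ a <= u x, 0 < e &
    forall y, ratr q <= v y -> r + e <= eucl_dist x y]].
rewrite (_ : mkset _ = \bigcup_q T q).
  apply: bigcupT_measurable_rat => q; apply: is_interval_measurable.
  move=> a b [[q0 qa a1] _] [[_ qb b1] [x [e [bx e0 xe]]]] z /andP[az zb].
  split; first by split=> //; [exact: le_trans qa az|exact: le_trans zb b1].
  by exists x, e; split=> //; exact: le_trans bx.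
apply/seteqP; split=> a /=; last first.
  move=> [q _ [[q0 qa a1] [x [e [ax e0 xe]]]]]; split.
    by rewrite a1 (lt_le_trans q0 qa).
  exists x, e; split=> // y ay; apply: xe; exact: le_trans ay.
move=> [/andP[a0 a1] [x [e [ax e0 xe]]]].
apply: contrapT => nT.
(* If every rational level below [a] failed with the margin [e / 2], the left limit would give a
   point of the [a]-cut of [v] within [r + e / 2] of [x], against the margin [e]. *)
have [|y ay] := @cut_left_limit v x (r + e / 2) a uv bv a0 _; last first.
  by move=> /(le_trans (xe _ ay)); lra.
move=> q d /andP[q0 qa] d0; apply: contrapT => nq; apply: nT.
have [s] := rat_in_itvoo qa; rewrite in_itv/= => /andP[qs sa].
exists s => //; split; first by split=> //; [exact: lt_trans qs|exact: ltW].
exists x, (e / 2); split=> //; first by rewrite divr_gt0.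
move=> y sy; rewrite leNgt; apply/negP => xy; apply: nq; exists y.
  exact: le_trans (ltW qs) sy.
by rewrite ltW// (lt_le_trans xy)// lerDl ltW.
Qed.

(** For [r >= 0] the distance exceeds [r] exactly when some point of one of the two cuts is farther
    than [r], by a positive margin, from the whole other cut. This gives one set of far levels for
    each direction. *)
Lemma measurable_cut_dist u v : bounded_cut_fuzzy u -> bounded_cut_fuzzy v ->
  measurable_fun [set: R] (cut_dist u v).
Proof.
move=> bu bv mT; apply: (measurability _ (RGenOInfty.measurableE R)) => //.
move=> _ [_ [r ->] <-]; rewrite setTI.
have [r0|r0] := ltP r 0.
  rewrite (_ : _ @^-1` _ = setT)//; apply/seteqP; split=> // a _ /=.
  by rewrite in_itv/= andbT (lt_le_trans r0)// cut_dist_ge0.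
pose F u' v' := [set a | 0 < a <= 1 /\ exists (x : 'rV[R]_m) e,
  [/\ a <= u' x, 0 < e & forall y : 'rV[R]_m, a <= v' y -> r + e <= eucl_dist x y]].
rewrite (_ : _ @^-1` _ = F u v `|` F v u); last first.
  apply/seteqP; split=> a /=; rewrite in_itv/= andbT.
    have [a01|a01] := boolP (0 < a <= 1); last first.
      by rewrite /cut_dist (negPf a01) ltNge r0.
    move=> rlt; apply: contrapT => nF; move: rlt; rewrite ltNge => /negP; apply.
    apply/cut_dist_leP => //; split=> x e ax e0; apply: contrapT => nx; apply: nF.
      left; split=> //; exists x, e; split=> // y ay; rewrite leNgt; apply/negP => xy.
      by apply: nx; exists y.
    right; split=> //; exists x, e; split=> // y ay; rewrite leNgt; apply/negP => xy.
    by apply: nx; exists y => //; rewrite eucl_distC.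
  have nle (u' v' : 'rV[R]_m -> R) : bounded_cut_fuzzy u' -> bounded_cut_fuzzy v' ->
      F u' v' a -> r < cut_dist u' v' a.
    move=> bu' bv' [a01 [x [e [ax e0 xe]]]]; rewrite ltNge; apply/negP.
    move=> /(cut_dist_leP _ bu' bv' a01)[H _]; have [y ay] := H _ _ ax e0.
    by rewrite ltNge xe.
  by move=> [/nle|/nle]; [|rewrite cut_distC]; exact.
by apply: measurableU; exact: measurable_far_levels.
Qed.

(** This turns the integral of an extended-real distance into that of a real function on the whole
    line; outside []0, 1]] the integrand is [0] because [p != 0]. *)
Lemma dpE p u v : p != 0 -> bounded_cut_fuzzy u -> bounded_cut_fuzzy v ->
  dp p u v = ((\int[lebesgue_measure]_a ((cut_dist u v a `^ p)%R)%:E) `^ p^-1)%E.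
Proof.
move=> p0 bu bv; rewrite /dp; congr poweR.
have eqH a : a \in `]0, 1]%classic ->
    (hausdorff_dist (fuzzy_cut u a) (fuzzy_cut v a) `^ p = (cut_dist u v a `^ p)%:E)%E.
  by rewrite inE/= in_itv/= => a01; rewrite -cut_distE.
have mp : measurable_fun [set: R] (fun a => (cut_dist u v a `^ p)%:E).
  apply/measurable_EFinP; apply: (measurableT_comp (measurable_powR p)).
  exact: measurable_cut_dist.
(* Level [0], where the distance may be infinite, is a null set. *)
rewrite -integral_itv_obnd_cbnd; last first.
  apply: (eq_measurable_fun (fun a => (cut_dist u v a `^ p)%:E)).
    by move=> a a01; rewrite eqH.
  exact: measurable_funTS.
rewrite [LHS]integral_mkcond; apply: eq_integral => a _; rewrite patchE.
case: ifPn => [/eqH//|]; rewrite notin_setE/= in_itv/= => /negP a01.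
by rewrite /cut_dist (negPf a01) powR0.
Qed.

End BoundedCuts.

Opaque hausdorff_dist.

(** * The distance [d_p] *)

Section LpDistance.
Context {R : realType} {m : nat}.
Local Notation mu := (@lebesgue_measure R).
Implicit Types (u v w : 'rV[R]_m -> R) (p : R).

(** Otherwise []a, b[] would lie in a null set, against its positive length. *)
Lemma ae_itv_oo (P : set R) (a b : R) : a < b -> {ae mu, forall x, P x} ->
  exists2 c, a < c < b & P c.
Proof.
move=> ab [N [mN N0 PN]]; apply: contrapT => nP.
have : (mu `]a, b[ <= mu N)%E.
  apply: le_measure; rewrite ?inE//.
  move=> c; rewrite /= in_itv/= => cab; apply: PN => /= Pc.
  by apply: nP; exists c.
by rewrite N0 lebesgue_measure_itv/= lte_fin ab -EFinD lee_fin subr_le0 leNgt ab.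
Qed.

Lemma ae_mono (P Q : set R) : P `<=` Q -> {ae mu, forall x, P x} ->
  {ae mu, forall x, Q x}.
Proof.
move=> PQ [N [mN N0 PN]]; exists N; split=> // x /= nQ.
by apply: PN => /PQ.
Qed.

Lemma ae_le_Lnorm p (f g : R -> R) : 0 < p ->
  measurable_fun [set: R] f -> measurable_fun [set: R] g ->
  {ae mu, forall x, `|f x| <= `|g x|} ->
  ('N[mu]_p%:E[EFin \o f] <= 'N[mu]_p%:E[EFin \o g])%E.
Proof.
move=> p0 mf mg fg; rewrite unlock.
have mp (h : R -> R) : measurable_fun [set: R] h ->
    measurable_fun [set: R] (fun x => `|(EFin \o h) x| `^ p)%E.
  move=> mh; apply: (measurableT_comp (measurable_poweR p)).
  by apply: measurableT_comp => //; exact/measurable_EFinP.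
apply: gt0_ler_poweR; rewrite ?invr_ge0 ?(ltW p0)//.
- by rewrite in_itv/= leey andbT integral_ge0// => x _; exact: poweR_ge0.
- by rewrite in_itv/= leey andbT integral_ge0// => x _; exact: poweR_ge0.
apply: ae_ge0_le_integral => //.
- by move=> x _; exact: poweR_ge0.
- exact: mp.
- by move=> x _; exact: poweR_ge0.
- exact: mp.
- apply: ae_mono fg => x fgx _.
  by rewrite gt0_ler_poweR ?(ltW p0)// in_itv/= ?leey ?andbT ?lee_fin.
Qed.

(** Writing [dp] as an [L^p] norm gives access to Minkowski's inequality and to the vanishing almost
    everywhere of functions of norm [0]. *)
Lemma dp_Lnorm p u v : p != 0 -> bounded_cut_fuzzy u -> bounded_cut_fuzzy v ->
  dp p u v = 'N[mu]_p%:E[EFin \o cut_dist u v]%E.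
Proof.
move=> p0 bu bv; rewrite dpE// unlock; apply: (congr1 (fun z => z `^ p^-1)%E).
apply: eq_integral => a _ /=.
by rewrite ger0_norm// cut_dist_ge0.
Qed.

Lemma dp_ge0 p u v : (0 <= dp p u v)%E.
Proof. exact: poweR_ge0. Qed.

Lemma dpC p u v : dp p u v = dp p v u.
Proof.
by rewrite /dp; under eq_integral do rewrite hausdorff_distC.
Qed.

Lemma dp_triangle p v u w : 1 <= p -> bounded_cut_fuzzy u ->
  bounded_cut_fuzzy v -> bounded_cut_fuzzy w ->
  (dp p u w <= dp p u v + dp p v w)%E.
Proof.
move=> p1 bu bv bw; have p0 : 0 < p by exact: lt_le_trans p1.
have muv := measurable_cut_dist bu bv; have mvw := measurable_cut_dist bv bw.
rewrite !dp_Lnorm ?gt_eqF//; apply: le_trans; last exact: minkowski_EFin.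
apply: ae_le_Lnorm => //; first exact: measurable_cut_dist.
  exact: measurable_funD.
apply: aeW => a; rewrite !ger0_norm ?addr_ge0 ?cut_dist_ge0//.
exact: cut_dist_triangle.
Qed.

Lemma dpxx p u : p != 0 -> bounded_cut_fuzzy u -> dp p u u = 0%E.
Proof.
move=> p0 bu; rewrite dpE// integral0_eq ?poweR0r ?invr_eq0// => a _.
rewrite /cut_dist; case: ifPn => [/andP[a0 a1]|_]; last by rewrite powR0.
rewrite hausdorff_distxx ?powR0//; apply: fuzzy_cut_nonempty; last by rewrite ltW.
by case: bu.
Qed.

(** If [v x < u x], some level strictly between the two values is one of the almost all levels at
    which the cuts coincide; but there [x] belongs to only one of them. *)
Lemma dp_eq0 p u v : 0 < p -> bounded_cut_fuzzy u -> bounded_cut_fuzzy v ->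
  dp p u v = 0%E -> u = v.
Proof.
move=> p0 bu bv; rewrite dp_Lnorm ?gt_eqF// => /Lnorm_eq0_eq0 => /(_ _ _)/wrap[].
  by apply/measurable_EFinP; exact: measurable_cut_dist.
  by [].
move=> uv0.
suff le u' v' : bounded_cut_fuzzy u' -> bounded_cut_fuzzy v' ->
    {ae mu, forall a, cut_dist u' v' a = 0} -> forall x, u' x <= v' x.
  have uv : {ae mu, forall a, cut_dist u v a = 0}.
    by apply: ae_mono uv0 => a /(_ I)[].
  have vu : {ae mu, forall a, cut_dist v u a = 0}.
    by apply: ae_mono uv => a; rewrite cut_distC.
  by apply/funext => x; apply/eqP; rewrite eq_le !le.
move=> bu' bv' uv x; rewrite leNgt; apply/negP => vx_ux.
have [c /andP[vc cu] cuv] := ae_itv_oo vx_ux uv.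
have [fu _ uu _ _] := bu'; have [fv _ uv' _ _] := bv'.
have c0 : 0 < c by apply: le_lt_trans vc; have /andP[] := fv x.
have c01 : 0 < c <= 1.
  by rewrite c0 (le_trans (ltW cu))//; have /andP[] := fu x.
have := cut_distE bu' bv' c01; rewrite cuv => /esym/hausdorff_dist_eq0.
rewrite !fuzzy_cut_gt0// => /(_ (closed_cut _) (closed_cut _)) uvE.
have : [set x | c <= u' x] x by exact: ltW.
by rewrite uvE//= leNgt vc.
Qed.

Opaque dp.

(** The origin as a fuzzy number. All its cuts are [[set 0]], so the integrability condition of
    [Lp_fuzzy_number] becomes finiteness of the distance to [crisp0]. *)
Definition crisp0 (x : 'rV[R]_m) : R := (x == 0)%:R.

Lemma near_mono (P Q : set 'rV[R]_m) (x : 'rV[R]_m) :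
  P `<=` Q -> nbhs x P -> nbhs x Q.
Proof.
move=> PQ /nbhs_ballP[e e0 eP]; apply/nbhs_ballP.
by exists e => // y /eP/PQ.
Qed.

Lemma near_neq0 (x : 'rV[R]_m) : x != 0 ->
  nbhs x [set y : 'rV[R]_m | y != 0].
Proof.
move=> x0; have : 0 < eucl_dist x 0.
  by apply: lt_le_trans (norm_le_eucl_dist _ _); rewrite subr0 normr_gt0.
move=> /(near_eucl_dist x); apply: near_mono => y.
by apply: contraTneq => ->; rewrite ltxx.
Qed.

Lemma crisp0_gt0 x : (0 < crisp0 x) = (x == 0).
Proof. by rewrite /crisp0 ltr0n lt0b. Qed.

Lemma bounded_cut_crisp0 : bounded_cut_fuzzy crisp0.
Proof.
split.
- by move=> x; rewrite /crisp0; case: eqP => _; rewrite ?ler01 ?lexx.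
- by exists 0; rewrite /crisp0 eqxx.
- move=> x a; rewrite {1}/crisp0; case: eqVneq => [_ a1|x0 a0].
    apply: near_mono (near_eucl_dist x ltr01) => y _.
    by apply: le_lt_trans a1; rewrite /crisp0 lern1 leq_b1.
  by apply: near_mono (near_neq0 x0) => y /negPf; rewrite /crisp0 => ->.
- move=> x y l _; rewrite {1 2}/crisp0.
  case: (eqVneq x) => [->|_]; case: (eqVneq y) => [->|_];
    rewrite ?minxx ?ge_min ?ler0n ?orbT//.
  by rewrite !scaler0 addr0 /crisp0 eqxx.
- move=> a a0; apply/bounded_euclP; exists 0 => x /= /(lt_le_trans a0).
  by rewrite crisp0_gt0 => /eqP ->; rewrite eucl_distxx.
Qed.

Lemma fuzzy_cut_crisp0 a : 0 <= a <= 1 -> fuzzy_cut crisp0 a = [set 0].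
Proof.
rewrite /fuzzy_cut; case: (ltgtP 0 a) => //= [a0 a1|<- _].
  apply/seteqP; split=> [x /= /(lt_le_trans a0)|_ -> /=].
    by rewrite crisp0_gt0 => /eqP.
  by rewrite /crisp0 eqxx.
apply/seteqP; split=> [x clx|_ -> /=]; last first.
  by apply: subset_closure; rewrite /= crisp0_gt0.
apply/eqP/negPn/negP => /near_neq0/clx[y [/=]].
by rewrite crisp0_gt0 => ->.
Qed.

Transparent dp.

Lemma dp_crisp0 p u : dp p u crisp0 =
  ((\int[mu]_(a in `[0%R, 1%R]%classic)
     hausdorff_dist (fuzzy_cut u a) [set 0%R] `^ p) `^ p^-1)%E.
Proof.
rewrite /dp; apply: (congr1 (fun z => z `^ p^-1)%E).
apply: eq_integral => a /set_mem a01.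
by rewrite fuzzy_cut_crisp0.
Qed.

Opaque dp.

Lemma hausdorff_dist_cut0_le u a b : normal_fuzzy u -> 0 < a <= b -> b <= 1 ->
  (hausdorff_dist (fuzzy_cut u b) [set 0%R] <=
   hausdorff_dist (fuzzy_cut u a) [set 0%R])%E.
Proof.
move=> nu /andP[a0 ab] b1; have b0 : 0 < b := lt_le_trans a0 ab.
have cua : fuzzy_cut u a !=set0.
  by apply: fuzzy_cut_nonempty; rewrite ?(ltW a0)//= (le_trans ab).
have cub : fuzzy_cut u b !=set0 by apply: fuzzy_cut_nonempty; rewrite ?(ltW b0).
have := hausdorff_dist_ge0 [set 0] cua.
case ua : (hausdorff_dist (fuzzy_cut u a) _) => [r| |]// _; last by rewrite leey.
apply/hausdorff_dist0_leP => //; rewrite fuzzy_cut_gt0// => x /= bx.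
have /hausdorff_dist0_leP : (hausdorff_dist (fuzzy_cut u a) [set 0%R] <= r%:E)%E.
  by rewrite ua.
by apply=> //; rewrite fuzzy_cut_gt0//=; exact: le_trans bx.
Qed.

(** The cuts decrease with the level, so an unbounded cut at [a] makes the integrand [+oo] on all of
    []0, a]], and the integral would be infinite. *)
Lemma Lp_bounded_cuts p u : 0 < p -> fuzzy_set u -> normal_fuzzy u ->
  (dp p u crisp0 < +oo)%E -> forall a, 0 < a -> bounded_set [set x | a <= u x].
Proof.
move=> p0 fu nu; rewrite dp_crisp0 => /lty_poweRy.
rewrite invr_eq0 gt_eqF// => /(_ isT) intfin a a0.
have [a1|a1] := leP a 1; last first.
  apply/bounded_euclP; exists 0 => x /= /(lt_le_trans a1); rewrite ltNge.
  by have /andP[_ ->] := fu x.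
have cu : fuzzy_cut u a !=set0 by apply: fuzzy_cut_nonempty; rewrite ?(ltW a0).
rewrite -fuzzy_cut_gt0//; apply/bounded_hausdorff_dist0 => //.
rewrite ltNge leye_eq; apply/negP => /eqP uaoo; move: intfin.
set f := fun b => (hausdorff_dist (fuzzy_cut u b) [set 0%R] `^ p)%E.
(* [measurable_cut_dist] presupposes bounded cuts; here measurability comes from monotonicity, the
   superlevel sets being intervals. *)
have mf : measurable_fun (`[0%R, 1%R]%classic : set R) f.
  apply/emeasurable_fun_itv_obnd_cbndP.
  apply: (measurableT_comp (measurable_poweR p)).
  move=> mD; apply: (measurability _ (ErealGenOInfty.measurableE R)) => //.
  move=> _ [_ [r ->] <-]; apply: is_interval_measurable => b c.
  rewrite /= !in_itv/= !andbT => -[/andP[b0 b1] _] [/andP[c0 c1] rc] z /andP[bz zc].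
  have z0 : 0 < z := lt_le_trans b0 bz.
  rewrite /= !in_itv/= andbT; split; first by rewrite z0 (le_trans zc).
  by apply: lt_le_trans rc _; apply: hausdorff_dist_cut0_le; rewrite ?z0.
rewrite ltNge => /negP; apply.
apply: (@le_trans _ _ (\int[mu]_(b in `]0%R, a]%classic) f b)%E); last first.
  apply: ge0_subset_integral => //; last 1 first.
  - move=> b /=; rewrite !in_itv/= => /andP[b0 ba].
    by rewrite (ltW b0) (le_trans ba).
  - by move=> b _; exact: poweR_ge0.
rewrite (eq_integral (cst +oo%E)).
  rewrite integral_cst//= lebesgue_measure_itv/= lte_fin a0 sube0.
  by rewrite mulyr gtr0_sg// mul1e.
move=> b; rewrite inE/= in_itv/= => ba; rewrite /f.
suff -> : hausdorff_dist (fuzzy_cut u b) [set 0%R] = +oo%E.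
  by rewrite poweRyr// gt_eqF.
by apply/eqP; rewrite -leye_eq -uaoo hausdorff_dist_cut0_le.
Qed.

(** Separates the part independent of [p] from the finiteness condition, now stated through [dp], to
    which the triangle inequality applies. *)
Lemma Lp_fuzzy_numberP p u : 0 < p ->
  Lp_fuzzy_number p u <-> bounded_cut_fuzzy u /\ (dp p u crisp0 < +oo)%E.
Proof.
move=> p0; rewrite dp_crisp0; split=> [[fu nu uu cu Lu]|[[fu nu uu cu _] Lu]].
  split; last exact: Lu.
  split; [exact: fu|exact: nu|exact: uu|exact: cu|].
  by apply: (Lp_bounded_cuts p0 fu nu); rewrite dp_crisp0; exact: Lu.
by split; [exact: fu|exact: nu|exact: uu|exact: cu|exact: Lu].
Qed.

(** Triangle inequality through [crisp0]. *)
Lemma dp_fin_num p u v : 1 <= p -> Lp_fuzzy_number p u -> Lp_fuzzy_number p v ->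
  dp p u v \is a fin_num.
Proof.
move=> p1; have p0 : 0 < p by exact: lt_le_trans p1.
move=> /(Lp_fuzzy_numberP _ p0)[bu Lu] /(Lp_fuzzy_numberP _ p0)[bv Lv].
rewrite ge0_fin_numE; last exact: dp_ge0.
apply: le_lt_trans (dp_triangle p1 bu bounded_cut_crisp0 bv) _.
by apply: lte_add_pinfty; [exact: Lu|rewrite dpC; exact: Lv].
Qed.

End LpDistance.

(** * Density *)

Section Truncation.
Context {R : realType} {m : nat}.
Local Notation mu := (@lebesgue_measure R).
Implicit Types (u v w : 'rV[R]_m -> R) (p : R).

Lemma sub_bounded_set (A B : set 'rV[R]_m) : A `<=` B -> bounded_set B ->
  bounded_set A.
Proof.
move=> AB /bounded_euclP[M BM]; apply/bounded_euclP; exists M => x Ax.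
exact/BM/AB.
Qed.

Lemma fuzzy_number_bounded_cut u : fuzzy_number u -> bounded_cut_fuzzy u.
Proof.
move=> [fu nu uu cu bu]; split=> // a a0; apply: sub_bounded_set bu => x /= ax.
by rewrite /fuzzy_cut eqxx; apply: subset_closure; exact: lt_le_trans ax.
Qed.

Lemma cut_dist_crisp0_leP u a (r : R) : bounded_cut_fuzzy u -> 0 < a <= 1 ->
  cut_dist u crisp0 a <= r <-> forall x, a <= u x -> eucl_dist x 0 <= r.
Proof.
move=> bu a01; rewrite -lee_fin cut_distE//; last exact: bounded_cut_crisp0.
have /andP[a0 a1] := a01.
rewrite fuzzy_cut_crisp0 ?(ltW a0)// hausdorff_dist0_leP ?fuzzy_cut_gt0//.
rewrite -fuzzy_cut_gt0//; apply: fuzzy_cut_nonempty; last by rewrite (ltW a0).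
by case: bu.
Qed.

Lemma integral_cut_dist p u v : p != 0 ->
  (\int[mu]_a ((cut_dist u v a `^ p)%R)%:E =
   \int[mu]_(a in `]0%R, 1%R]) ((cut_dist u v a `^ p)%R)%:E)%E.
Proof.
move=> p0; rewrite [RHS]integral_mkcond; apply: eq_integral => a _.
rewrite patchE; case: ifPn => //; rewrite notin_setE/= in_itv/= => /negP a01.
by rewrite /cut_dist (negPf a01) powR0.
Qed.

Lemma measurable_cut_dist_powR p u v : bounded_cut_fuzzy u ->
  bounded_cut_fuzzy v ->
  measurable_fun [set: R] (fun a : R => ((cut_dist u v a `^ p)%R)%:E).
Proof.
move=> bu bv; apply/measurable_EFinP; apply: (measurableT_comp (measurable_powR p)).
exact: measurable_cut_dist.
Qed.

Lemma dp_le p u v (r : R) : 0 < p -> 0 <= r -> bounded_cut_fuzzy u ->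
  bounded_cut_fuzzy v ->
  (\int[mu]_a ((cut_dist u v a `^ p)%R)%:E <= (r `^ p)%:E)%E ->
  (dp p u v <= r%:E)%E.
Proof.
move=> p0 r0 bu bv H; rewrite dpE ?gt_eqF//.
have -> : r%:E = ((r `^ p)%:E `^ p^-1)%E.
  by rewrite poweR_EFin -powRrM mulfV ?gt_eqF// powRr1.
apply: gt0_ler_poweR => //; rewrite ?invr_ge0 ?(ltW p0)// in_itv/= leey andbT.
  by apply: integral_ge0 => a _; rewrite lee_fin powR_ge0.
by rewrite lee_fin powR_ge0.
Qed.

Lemma integral_cut_dist_lty p u v : 0 < p -> bounded_cut_fuzzy u ->
  bounded_cut_fuzzy v -> (dp p u v < +oo)%E ->
  (\int[mu]_a ((cut_dist u v a `^ p)%R)%:E < +oo)%E.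
Proof.
move=> p0 bu bv; rewrite dpE ?gt_eqF// => /lty_poweRy.
by apply; rewrite invr_eq0 gt_eqF.
Qed.

(** A bound [M] for the support bounds every positive cut, so the integrand is at most [M ^ p] on an
    interval of length [1]. *)
Lemma fuzzy_number_Lp p u : 0 < p -> fuzzy_number u -> Lp_fuzzy_number p u.
Proof.
move=> p0 nu; have bu := fuzzy_number_bounded_cut nu.
apply/Lp_fuzzy_numberP => //; split; first exact: bu.
have [_ _ _ _ /bounded_euclP[M uM]] := nu.
have M0 : 0 <= M.
  have [_ [x ux] _ _ _] := nu; apply: le_trans (eucl_dist_ge0 x 0) (uM _ _).
  by rewrite /fuzzy_cut eqxx; apply: subset_closure; rewrite /= ux.
apply: (@le_lt_trans _ _ M%:E); last by rewrite ltry.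
apply: dp_le => //; first exact: bounded_cut_crisp0.
rewrite integral_cut_dist ?gt_eqF//.
apply: (@le_trans _ _ (\int[mu]_(a in `]0%R, 1%R]) (cst (M `^ p)%:E) a)%E).
  apply: ge0_le_integral => //.
  - by move=> a _; rewrite lee_fin powR_ge0.
  - apply: measurable_funTS; apply: measurable_cut_dist_powR => //.
    exact: bounded_cut_crisp0.
  - move=> a; rewrite /= in_itv/= => a01; rewrite lee_fin.
    rewrite ge0_ler_powR ?nnegrE ?(ltW p0) ?cut_dist_ge0//.
    apply/cut_dist_crisp0_leP => // x ax; apply: uM.
    have /andP[a0 _] := a01.
    by rewrite /fuzzy_cut eqxx; apply: subset_closure; exact: lt_le_trans ax.
rewrite integral_cst//= lebesgue_measure_itv/= lte_fin ltr01 sube0 mule1.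
exact: lexx.
Qed.

(** Dropping small values to [0] puts the support inside the cut at [c]. That cut is closed, which
    preserves upper semicontinuity. *)
Definition truncate u (c : R) x : R := if c <= u x then u x else 0.

Lemma truncate_le u c x : fuzzy_set u -> truncate u c x <= u x.
Proof. by rewrite /truncate => /(_ x)/andP[u0 u1]; case: ifP. Qed.

Lemma bounded_cut_truncate u c : 0 < c <= 1 -> bounded_cut_fuzzy u ->
  bounded_cut_fuzzy (truncate u c).
Proof.
move=> /andP[c0 c1] [fu nu uu cu bu]; split.
- move=> x; rewrite /truncate; case: ifP => _; first exact: fu.
  by rewrite lexx ler01.
- by have [x ux] := nu; exists x; rewrite /truncate ux c1.
- move=> x a; rewrite {1}/truncate; case: ifPn => [_ uxa|]; last first.
    rewrite -ltNge => uxc a0; apply: near_mono (uu _ _ uxc) => y /=.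
    by rewrite /truncate leNgt => ->.
  apply: near_mono (uu _ _ uxa) => y /=; apply: le_lt_trans.
  exact: truncate_le.
(* If an endpoint is dropped to [0], the minimum is at most [0]; otherwise both endpoints, and hence
   the point between them, have height at least [c]. *)
- move=> x y l l01; have z0 : 0 <= truncate u c (l *: x + (1 - l) *: y).
    by rewrite /truncate; case: ifP => _//; have /andP[] := fu (l *: x + (1 - l) *: y).
  rewrite {1 2}/truncate; case: ifPn => [cx|_]; last by rewrite ge_min z0.
  case: ifPn => [cy|_]; last by rewrite ge_min z0 orbT.
  have cz := cu x y l l01.
  by rewrite /truncate (le_trans _ cz)// le_min cx cy.
- move=> a a0; apply: sub_bounded_set (bu _ a0) => x /= /le_trans; apply.
  exact: truncate_le.
Qed.

Lemma fuzzy_number_truncate u c : 0 < c <= 1 -> bounded_cut_fuzzy u ->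
  fuzzy_number (truncate u c).
Proof.
move=> c01 bu; have [? ? ? ? _] := bounded_cut_truncate c01 bu; split=> //.
have /andP[c0 _] := c01; have [_ _ uu _ /(_ _ c0)] := bu.
apply: sub_bounded_set; rewrite /fuzzy_cut eqxx.
rewrite [X in _ `<=` X](_ : _ = closure [set x | c <= u x]); last first.
  by apply/closure_id; exact: closed_cut.
by apply: closure_subset => x /=; rewrite /truncate; case: ifPn => //; rewrite ltxx.
Qed.

Lemma cut_dist_truncate_eq0 u c a : 0 < c <= a -> bounded_cut_fuzzy u ->
  cut_dist u (truncate u c) a = 0.
Proof.
move=> /andP[c0 ca] bu; rewrite /cut_dist; case: ifPn => // /andP[a0 a1].
rewrite (_ : fuzzy_cut (truncate u c) a = fuzzy_cut u a).
  rewrite hausdorff_distxx//; apply: fuzzy_cut_nonempty; last by rewrite (ltW a0).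
  by case: bu.
rewrite !fuzzy_cut_gt0//; apply/seteqP; split=> x /= ax.
  by apply: le_trans ax _; apply: truncate_le; case: bu.
by rewrite /truncate (le_trans ca).
Qed.

(** Triangle inequality through [crisp0]: the cuts of the truncation are subsets of those of [u],
    hence no farther from the origin. *)
Lemma cut_dist_truncate_le u c a : 0 < c <= 1 -> bounded_cut_fuzzy u ->
  cut_dist u (truncate u c) a <= 2 * cut_dist u crisp0 a.
Proof.
move=> c01 bu; have bt := bounded_cut_truncate c01 bu.
have b0 := @bounded_cut_crisp0 R m.
apply: le_trans (cut_dist_triangle _ bu b0 bt) _.
rewrite mulr2n mulrDl mul1r lerD2l.
have [a01|a01] := boolP (0 < a <= 1); last by rewrite /cut_dist (negPf a01).
rewrite cut_distC; apply/cut_dist_crisp0_leP => // x ax.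
have /cut_dist_crisp0_leP : cut_dist u crisp0 a <= cut_dist u crisp0 a by [].
apply=> //; apply: le_trans ax _; apply: truncate_le; by case: bu.
Qed.

Lemma dp_truncate_lt p u (e : R) : 0 < p -> Lp_fuzzy_number p u -> 0 < e ->
  exists2 v, fuzzy_number v & (dp p u v < e%:E)%E.
Proof.
move=> p0 /(Lp_fuzzy_numberP _ p0)[bu Lu] e0.
pose c n : R := n.+1%:R^-1.
have c01 n : 0 < c n <= 1 by rewrite /c invr_gt0 ltr0Sn invf_le1// ler1n.
pose f n (a : R) := ((cut_dist u (truncate u (c n)) a `^ p)%R)%:E.
have b0 := @bounded_cut_crisp0 R m.
have bt n : bounded_cut_fuzzy (truncate u (c n)) by exact: bounded_cut_truncate.
pose g (a : R) := ((2 `^ p)%:E * ((cut_dist u crisp0 a `^ p)%R)%:E)%E.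
have mf n : measurable_fun [set: R] (f n) by exact: measurable_cut_dist_powR.
have mc := measurable_cut_dist_powR p bu b0.
have ig : mu.-integrable [set: R] g.
  apply: integrableZl => //; apply/integrableP; split => //.
  under eq_integral do rewrite gee0_abs ?lee_fin ?powR_ge0//.
  exact: integral_cut_dist_lty.
have fcvg (a : R) : f ^~ a @ \oo --> 0%E.
  apply: cvg_near_cst; have [a0|a0] := ltP 0 a.
    near=> n; rewrite /f cut_dist_truncate_eq0 ?powR0 ?gt_eqF//.
    have /andP[-> _] := c01 n; rewrite ltW//; near: n.
    exact: (near_infty_natSinv_lt (PosNum a0)).
  by apply: nearW => n; rewrite /f /cut_dist ltNge a0/= powR0 ?gt_eqF.
have fg (a : R) n : (`|f n a| <= g a)%E.
  rewrite gee0_abs; last by rewrite lee_fin powR_ge0.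
  rewrite /g -EFinM lee_fin -powRM ?cut_dist_ge0//.
  rewrite ge0_ler_powR ?nnegrE ?(ltW p0) ?mulr_ge0 ?cut_dist_ge0//.
  exact: cut_dist_truncate_le.
have [||||] := @dominated_convergence _ _ _ mu setT measurableT f (cst 0%E) g mf.
- exact: measurable_cst.
- by apply: aeW => a _; exact: fcvg.
- exact: ig.
- by apply: aeW => a n _; exact: fg.
move=> _ _; rewrite integral0_eq//.
(* The target is [(e / 2) ^ p], since [dp_le] yields a non-strict bound only. *)
have d0 : (0 < ((e / 2) `^ p)%:E)%E by rewrite lte_fin powR_gt0// divr_gt0.
move=> /(_ _ (open_ereal_lt' d0))[n _ /(_ n (leqnn n))/= /ltW fn].
exists (truncate u (c n)); first exact: fuzzy_number_truncate.
apply: (@le_lt_trans _ _ (e / 2)%:E); last by rewrite lte_fin; lra.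
by apply: dp_le => //; rewrite divr_ge0// ltW.
Unshelve. all: by end_near. Qed.

End Truncation.

(** * Completeness *)

Section CutwiseLimit.
Context {R : realType} {m : nat}.
Implicit Types (x y z : 'rV[R]_m).

Lemma closed_eucl_ball x (M : R) : closed [set y | eucl_dist x y <= M].
Proof.
move=> y cly /=; apply/ler_addgt0Pl => e e0.
have [z [/= xz yz]] := cly _ (near_eucl_dist y e0).
apply: le_trans (eucl_dist_triangle z _ _) _.
by rewrite (eucl_distC z) addrC lerD// ltW.
Qed.

(** The sequence stays in a compact ball; [z] is a cluster point. The tail from [i] on lies in the
    closed ball of radius [B i] about [s i], and so does [z]. *)
Lemma eucl_cauchy_limit (s : nat -> 'rV[R]_m) (B : nat -> R) :
  (forall i j, (i <= j)%N -> eucl_dist (s i) (s j) <= B i) ->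
  exists z, forall i, eucl_dist (s i) z <= B i.
Proof.
move=> sB; pose A := [set y | eucl_dist (s 0%N) y <= B 0%N].
have bA : bounded_set A.
  apply/bounded_euclP; exists (B 0%N + eucl_dist (s 0%N) 0) => x Ax.
  apply: le_trans (eucl_dist_triangle (s 0%N) _ _) _.
  by rewrite lerD2r eucl_distC.
have cpt := bounded_closed_compact bA (@closed_eucl_ball _ _).
have [|z [_ sz]] := cpt (s @ \oo) _.
  by exists 0%N => // k _ /=; exact: sB.
exists z => i; apply: (@closed_eucl_ball (s i) (B i)) => U Uz.
have [|t [/= st Ut]] := sz [set y | eucl_dist (s i) y <= B i] _ _ Uz.
  by exists i => // k /= ik; exact: sB.
by exists t.
Qed.

Variable u_ : nat -> 'rV[R]_m -> R.
Hypothesis bu : forall n, bounded_cut_fuzzy (u_ n).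

(** For [a > 0] this is the Kuratowski lower limit of the cuts at level [a]. It is closed, convex
    and decreasing in [a] at all levels, before any convergence is known. *)
Definition limit_cut (a : R) : set 'rV[R]_m := [set x | forall e, 0 < e ->
  exists N, forall n, (N <= n)%N -> exists2 y, a <= u_ n y & eucl_dist x y < e].

Lemma limit_cut_le a b : a <= b -> limit_cut b `<=` limit_cut a.
Proof.
move=> ab x Kx e /Kx[N HN]; exists N => n /HN[y by_ xy]; exists y => //.
exact: le_trans by_.
Qed.

Lemma closed_limit_cut a : closed (limit_cut a).
Proof.
move=> x clx e e0; have e20 : 0 < e / 2 by rewrite divr_gt0.
have [z [/= Kz xz]] := clx _ (near_eucl_dist x e20).
have [N HN] := Kz _ e20; exists N => n /HN[y ay zy]; exists y => //.
by apply: le_lt_trans (eucl_dist_triangle z _ _) _; lra.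
Qed.

Lemma limit_cut_convex a x y (l : R) : 0 <= l <= 1 -> limit_cut a x ->
  limit_cut a y -> limit_cut a (l *: x + (1 - l) *: y).
Proof.
move=> l01 Kx Ky e e0; have [N HN] := Kx _ e0; have [N' HN'] := Ky _ e0.
exists (maxn N N') => n; rewrite geq_max => /andP[/HN[x' ax' xx'] /HN'[y' ay' yy']].
exists (l *: x' + (1 - l) *: y'); last exact: eucl_dist_convex.
have [_ _ _ cu _] := bu n; apply: le_trans (cu x' y' l l01).
by rewrite le_min ax'.
Qed.

(** At such levels [limit_cut] is the Hausdorff limit of the cuts; the constant [C] may vary with
    the level. *)
Definition good_level (C a : R) := [/\ 0 < a <= 1, 0 < C &
  forall k, cut_dist (u_ k) (u_ k.+1) a <= C * 2 ^- k].

Lemma half_powS k : 2 ^- k.+1 = 2 ^- k / 2 :> R.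
Proof. by rewrite exprSr invfM mulrC. Qed.

Lemma half_pow_gt0 k : 0 < 2 ^- k :> R.
Proof. by rewrite invr_gt0 exprn_gt0. Qed.

Lemma half_pow_lt (e : R) : 0 < e -> exists N, forall n, (N <= n)%N -> 2 ^- n < e.
Proof.
move=> e0; have := near_infty_natSinv_expn_lt (PosNum e0).
move=> [N _ HN]; exists N => n Nn.
by have := HN n Nn; rewrite /= div1r.
Qed.

(** The bound is the exact geometric sum of the steps from [n] to [k - 1]; keeping the subtracted
    term lets the induction close. *)
Lemma cut_dist_good_level C a n k : good_level C a -> (n <= k)%N ->
  cut_dist (u_ n) (u_ k) a <= C * (2 * 2 ^- n - 2 * 2 ^- k).
Proof.
move=> [a01 C0 H]; elim: k => [|k IH].
  rewrite leqn0 => /eqP ->; rewrite subrr mulr0.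
  by apply/cut_dist_leP => //; split=> x e ax e0; exists x => //;
    rewrite eucl_distxx add0r.
rewrite leq_eqVlt => /predU1P[->|].
  rewrite subrr mulr0.
  by apply/cut_dist_leP => //; split=> x e ax e0; exists x => //;
    rewrite eucl_distxx add0r.
rewrite ltnS => /IH {}IH.
apply: le_trans (cut_dist_triangle _ (bu n) (bu k) (bu k.+1)) _.
have := H k; rewrite half_powS; lra.
Qed.

(** Some late cut comes close to [x]; the geometric bound leads back from it to index [n]. *)
Lemma limit_cut_near C a n x (e : R) : good_level C a -> limit_cut a x ->
  0 < e -> exists2 y, a <= u_ n y & eucl_dist x y < 2 * C * 2 ^- n + e.
Proof.
move=> gC Kx e0; have e20 : 0 < e / 2 by rewrite divr_gt0.
have [N HN] := Kx _ e20; have [z az xz] := HN _ (leq_maxl N n).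
have := cut_dist_good_level gC (leq_maxr N n).
have [a01 C0 _] := gC.
move=> /(cut_dist_leP _ (bu _) (bu _) a01)[_ /(_ _ _ az e20)[y ay yz]].
exists y => //; apply: le_lt_trans (eucl_dist_triangle z _ _) _.
have : 0 < C * 2 ^- (maxn N n) by rewrite mulr_gt0// half_pow_gt0.
by rewrite (eucl_distC z); lra.
Qed.

(** From [y] a chain of points is built through the successive cuts, each within [2 * C * 2 ^- k] of
    the previous one; its limit lies in [limit_cut]. *)
Lemma near_limit_cut C a n y : good_level C a -> a <= u_ n y ->
  exists2 x, limit_cut a x & eucl_dist y x <= 4 * C * 2 ^- n.
Proof.
move=> [a01 C0 H] ay.
(* The choice is made on pairs of an index and a point, so one function yields the whole chain. The
   slack [C * 2 ^- k] doubles the bound on the step and makes it strict. *)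
have /choice[f fP] : forall q : nat * 'rV[R]_m, exists y', a <= u_ q.1 q.2 ->
    a <= u_ q.1.+1 y' /\ eucl_dist q.2 y' < 2 * C * 2 ^- q.1.
  move=> [k z] /=; have Ck : 0 < C * 2 ^- k by rewrite mulr_gt0// half_pow_gt0.
  have [az|az] := leP a (u_ k z); last by exists z.
  have /(cut_dist_leP _ (bu _) (bu _) a01)[/(_ _ _ az Ck)[y' ay' zy'] _] := H k.
  by exists y' => _; split=> //; apply: lt_le_trans zy' _; lra.
pose s := fix s j := if j is j'.+1 then f ((n + j')%N, s j') else y.
have as_ j : a <= u_ (n + j)%N (s j).
  elim: j => [|j IH]; first by rewrite addn0.
  by rewrite addnS; have [] := fP (_, _) IH.
have sS j : eucl_dist (s j) (s j.+1) < 2 * C * 2 ^- (n + j).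
  by have [] := fP (_, _) (as_ j).
have sB i j : (i <= j)%N -> eucl_dist (s i) (s j) <= 4 * C * 2 ^- (n + i).
  (* The stronger telescoping bound is what the induction proves. *)
  move=> ij; apply: (@le_trans _ _ (4 * C * (2 ^- (n + i) - 2 ^- (n + j)))).
    elim: j ij => [|j IH].
      by rewrite leqn0 => /eqP ->; rewrite eucl_distxx subrr mulr0.
    rewrite leq_eqVlt => /predU1P[->|]; first by rewrite eucl_distxx subrr mulr0.
    rewrite ltnS => /IH {}IH; apply: le_trans (eucl_dist_triangle (s j) _ _) _.
    by have := sS j; rewrite addnS half_powS; lra.
  have : 0 < C * 2 ^- (n + j) by rewrite mulr_gt0// half_pow_gt0.
  by lra.
have [z sz] := eucl_cauchy_limit sB.
exists z; last by have := sz 0%N; rewrite addn0.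
move=> e e0; have C4 : 0 < e / (4 * C) by rewrite divr_gt0// mulr_gt0.
have [N HN] := half_pow_lt C4; exists (maxn N n) => k.
rewrite geq_max => /andP[Nk nk]; exists (s (k - n)%N).
  by have := as_ (k - n)%N; rewrite subnKC.
rewrite eucl_distC; apply: le_lt_trans (sz _) _; rewrite subnKC//.
by rewrite mulrC -ltr_pdivlMr ?HN// mulr_gt0.
Qed.

Lemma limit_cut_nonempty C a : good_level C a -> limit_cut a !=set0.
Proof.
move=> gC; have [/andP[a0 a1] _ _] := gC; have [_ [y uy] _ _ _] := bu 0.
have ay : a <= u_ 0 y by rewrite uy.
by have [x Kx _] := near_limit_cut gC ay; exists x.
Qed.

Lemma bounded_limit_cut C a : good_level C a -> bounded_set (limit_cut a).
Proof.
move=> gC; have [/andP[a0 a1] C0 _] := gC; have [_ _ _ _ /(_ _ a0)] := bu 0.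
move=> /bounded_euclP[M uM]; apply/bounded_euclP; exists (2 * C + 1 + M) => x Kx.
have [y ay xy] := limit_cut_near 0 gC Kx ltr01.
apply: le_trans (eucl_dist_triangle y _ _) _; apply: lerD (uM _ ay).
by move: xy; rewrite expr0 invr1 mulr1 => /ltW.
Qed.

End CutwiseLimit.

(** * The fuzzy set generated by a decreasing family of closed convex sets *)

Section LevelwiseSup.
Context {R : realType} {m : nat}.
Implicit Types (x y z : 'rV[R]_m).

Variables (D : set R) (K : R -> set 'rV[R]_m).
Hypothesis D01 : forall a, D a -> 0 < a <= 1.
Hypothesis dense_D : forall a b, 0 <= a -> a < b -> b <= 1 ->
  exists2 c, a < c < b & D c.
Hypothesis K_le : forall a b, a <= b -> K b `<=` K a.
Hypothesis closed_K : forall a, closed (K a).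
Hypothesis convex_K : forall a x y (l : R), 0 <= l <= 1 -> K a x -> K a y ->
  K a (l *: x + (1 - l) *: y).
Hypothesis K_nonempty : forall a, D a -> K a !=set0.
Hypothesis bounded_K : forall a, D a -> bounded_set (K a).

(** The alternative [a = 0] keeps the set nonempty, so the value is [0] at points outside every
    [K a]. Only levels of [D] count, as [K a] is known to be nonempty and bounded only there. *)
Definition level_sup x : R := sup [set a | a = 0 \/ D a /\ K a x].

Lemma has_sup_level_sup x : has_sup [set a | a = 0 \/ D a /\ K a x].
Proof.
split; first by exists 0; left.
by exists 1 => a [->|[/D01/andP[]]].
Qed.

Lemma level_sup_ge a x : D a -> K a x -> a <= level_sup x.
Proof.
move=> Da Kx; apply: ub_le_sup; first by have [] := has_sup_level_sup x.
by right.
Qed.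

Lemma level_sup_lt a x : 0 <= a -> a < level_sup x -> K a x.
Proof.
move=> a0 /(sup_gt (has_sup_level_sup x).1)[b [->|[Db Kb]] ab].
  by move: ab; rewrite ltNge a0.
exact: K_le (ltW ab) _ Kb.
Qed.

Lemma level_sup01 : fuzzy_set level_sup.
Proof.
move=> x; apply/andP; split.
  apply: ub_le_sup; first by have [] := has_sup_level_sup x.
  by left.
by apply: ge_sup => [|_ [->//|[/D01/andP[]]//]]; exists 0; left.
Qed.

(** For a level [b] of [D] between the value at [x] and [a], the complement of [K b] is a
    neighbourhood of [x] on which the function is at most [b]. *)
Lemma level_sup_usc : upper_semicontinuous level_sup.
Proof.
move=> x a xa; have /andP[x0 x1] := level_sup01 x.
have [a1|a1] := ltP 1 a.
  apply: near_mono (near_eucl_dist x ltr01) => y _.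
  by apply: le_lt_trans a1; have /andP[] := level_sup01 y.
have [b /andP[xb ba] Db] := dense_D x0 xa a1.
have nKx : ~ K b x by move=> /(level_sup_ge Db); rewrite leNgt xb.
have b0 : 0 <= b by rewrite (le_trans x0)// ltW.
have : nbhs x (~` K b).
  by apply: open_nbhs_nbhs; split=> //; exact/closed_openC.
apply: near_mono => y nKy; apply: le_lt_trans ba; rewrite leNgt; apply/negP.
by move=> /(level_sup_lt b0).
Qed.

Lemma level_sup_cut_bounded a : 0 < a ->
  bounded_set [set x | a <= level_sup x].
Proof.
move=> a0; have [a1|a1] := ltP 1 a.
  apply/bounded_euclP; exists 0 => x /= /(lt_le_trans a1).
  by rewrite ltNge; have /andP[_ ->] := level_sup01 x.
have [b /andP[b0 ba] Db] := dense_D (lexx 0) a0 a1.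
apply: sub_bounded_set (bounded_K Db) => x /= /(lt_le_trans ba).
exact/level_sup_lt/ltW.
Qed.

Lemma bounded_cut_level_sup : bounded_cut_fuzzy level_sup.
Proof.
split.
- exact: level_sup01.
(* Normality: points of [K b] with [b] tending to [1] stay in the bounded cut at [2^-1], and
   [cut_left_limit], centred at the origin, yields a point of height [1]. *)
- have half : 0 < 2^-1 :> R by rewrite invr_gt0.
  have /bounded_euclP[M HM] := level_sup_cut_bounded half.
  have [q e /andP[q0 q1] e0|x x1 _] :=
      @cut_left_limit _ _ level_sup 0 M 1 level_sup_usc level_sup_cut_bounded ltr01.
    (* The maximum with [2^-1] keeps the chosen point within the bound [M]. *)
    have [|||b /andP[qb b1] Db] := @dense_D (Num.max q 2^-1) 1.
    + by rewrite le_max ltW.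
    + by rewrite gt_max q1 invf_lt1// ltr1n.
    + by [].
    have [x Kx] := K_nonempty Db; have bx := level_sup_ge Db Kx.
    move: qb; rewrite gt_max => /andP[qb hb]; exists x.
      by rewrite (le_trans (ltW qb)).
    rewrite eucl_distC (@le_trans _ _ M)// ?lerDl ?(ltW e0)//.
    by apply: HM; rewrite /= (le_trans (ltW hb)).
  by exists x; apply/le_anti; rewrite x1 andbT; have /andP[] := level_sup01 x.
- exact: level_sup_usc.
(* If convexity failed, a level [b] of [D] strictly between the two sides would contradict the
   convexity of [K b]. *)
- move=> x y l l01; rewrite leNgt; apply/negP => zlt.
  have /andP[z0 _] := level_sup01 (l *: x + (1 - l) *: y).
  have min1 : Num.min (level_sup x) (level_sup y) <= 1.
    by rewrite ge_min; have /andP[_ ->] := level_sup01 x.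
  have [b /andP[zb]] := dense_D z0 zlt min1.
  rewrite lt_min => /andP[bx by_] Db.
  have b0 : 0 <= b by rewrite (le_trans z0)// ltW.
  have := level_sup_ge Db (convex_K l01 (level_sup_lt b0 bx) (level_sup_lt b0 by_)).
  by rewrite leNgt zb.
- exact: level_sup_cut_bounded.
Qed.

(** Cubes with centre [q.1] and half-side [q.2]: a countable base, which makes the exceptional
    levels countable. *)
Definition rational_cube (q : 'rV[rat]_m * rat) : set 'rV[R]_m :=
  [set y | forall i, `|y ord0 i - ratr (q.1 ord0 i)| < ratr q.2].

Lemma rational_cube_nbhs x (A : set 'rV[R]_m) : nbhs x A ->
  exists q, rational_cube q x /\ rational_cube q `<=` A.
Proof.
move=> /nbhs_ballP[e /= e0 eA].
have e20 : 0 < e / 2 by rewrite divr_gt0.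
have [r] := rat_in_itvoo e20; rewrite in_itv/= => /andP[r0 re].
have /choice[q qP] : forall i : 'I_m, exists c : rat, `|x ord0 i - ratr c| < ratr r.
  move=> i; have : x ord0 i - ratr r < x ord0 i by rewrite ltrBlDr ltrDl.
  move=> /rat_in_itvoo[c]; rewrite in_itv/= => /andP[c1 c2]; exists c.
  by rewrite gtr0_norm ?subr_gt0// ltrBlDl -ltrBlDr.
exists (\row_i q i, r); split=> [i|y yq]; first by rewrite mxE; exact: qP.
apply: eA; split=> // i j; rewrite (ord1 i).
have := qP j; have := yq j; rewrite /= mxE => h1 h2.
change (`|x ord0 j - y ord0 j| < e).
have -> : x ord0 j - y ord0 j =
    (x ord0 j - ratr (q j)) - (y ord0 j - ratr (q j)) by ring.
by apply: le_lt_trans (ler_normB _ _) _; lra.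
Qed.

(* A level [a] at which [K a] differs from the cut is the maximum of the limit
   over any rational cube which separates a point of the cut from [K a]. *)
Definition jump_levels : set R :=
  range (fun q => sup [set level_sup y | y in rational_cube q]).

Lemma countable_jump_levels : countable jump_levels.
Proof. by apply: (sub_countable (card_image_le _ _)); exact: countableP. Qed.

Lemma level_sup_cutE a : D a -> ~ jump_levels a ->
  [set x | a <= level_sup x] = K a.
Proof.
move=> Da nJ; have /andP[a0 _] := D01 Da.
apply/seteqP; split=> x /=; last exact: level_sup_ge.
move=> ax; apply: contrapT => nKx; apply: nJ.
have : nbhs x (~` K a).
  by apply: open_nbhs_nbhs; split=> //; exact/closed_openC.
move=> /rational_cube_nbhs[q [qx qK]]; exists q => //.
have ub y : rational_cube q y -> level_sup y <= a.
  move=> qy; rewrite leNgt; apply/negP => /(level_sup_lt (ltW a0)).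
  exact: qK.
apply/le_anti/andP; split.
  apply: ge_sup; first by exists (level_sup x), x.
  by move=> _ [y qy <-]; exact: ub.
apply: le_trans ax _; apply: ub_le_sup; last by exists x.
by exists a => _ [y qy <-]; exact: ub.
Qed.

End LevelwiseSup.

(** * The limit of a sequence with rapidly decreasing steps *)

Section Completeness.
Context {R : realType} {m : nat}.
Local Notation mu := (@lebesgue_measure R).

Lemma integral_le_dp p (u v : 'rV[R]_m -> R) (r : R) : 0 < p ->
  bounded_cut_fuzzy u -> bounded_cut_fuzzy v -> (dp p u v <= r%:E)%E ->
  (\int[mu]_a ((cut_dist u v a `^ p)%R)%:E <= (r `^ p)%:E)%E.
Proof.
move=> p0 bu bv; rewrite dpE ?gt_eqF//; set I := (\int[mu]_a _)%E => H.
have I0 : (0 <= I)%E by apply: integral_ge0 => a _; rewrite lee_fin powR_ge0.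
have -> : I = ((I `^ p^-1) `^ p)%E by rewrite -poweRrM mulVf ?gt_eqF// poweRe1.
rewrite -poweR_EFin; apply: gt0_ler_poweR => //; first exact: ltW.
  by rewrite in_itv/= leey poweR_ge0.
by rewrite in_itv/= leey andbT (le_trans _ H)// poweR_ge0.
Qed.

Variables (p : R) (u_ : nat -> 'rV[R]_m -> R).
Hypothesis p1 : 1 <= p.
Hypothesis bu : forall n, bounded_cut_fuzzy (u_ n).
Hypothesis dpu : forall k, (dp p (u_ k) (u_ k.+1) <= (4 ^- k)%:E)%E.

Let p0 : 0 < p. Proof. exact: lt_le_trans p1. Qed.

Let step k (a : R) := cut_dist (u_ k) (u_ k.+1) a.

Let step_ge0 k a : 0 <= step k a.
Proof. exact: cut_dist_ge0. Qed.

(* With the weights [2 ^+ k], finiteness of this integrable sum alone forces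
   geometric convergence of the cuts at the level [a]. *)
Definition weighted_steps (a : R) : \bar R :=
  (\sum_(k <oo) ((((2 ^+ k * step k a) `^ p)%R)%:E))%E.

Let term_ge0 k a : (0 <= ((((2 ^+ k * step k a) `^ p)%R)%:E))%E.
Proof. by rewrite lee_fin powR_ge0. Qed.

Let measurable_term k :
  measurable_fun [set: R] (fun a : R => (((2 ^+ k * step k a) `^ p)%R)%:E).
Proof.
apply/measurable_EFinP; apply: (measurableT_comp (measurable_powR p)).
by apply: measurable_funM => //; exact: measurable_cut_dist.
Qed.

Lemma weighted_steps_ge0 a : (0 <= weighted_steps a)%E.
Proof. exact: nneseries_ge0. Qed.

Lemma measurable_weighted_steps : measurable_fun [set: R] weighted_steps.
Proof. exact: ge0_emeasurable_sum. Qed.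

(** The [k]-th term integrates to at most [(2 ^+ k * 4 ^- k) ^ p = (2 ^- k) ^ p], which is at most
    [2 ^- k] since [p >= 1]; the geometric series sums to [2]. *)
Lemma integral_weighted_steps_le : (\int[mu]_a weighted_steps a <= 2%:E)%E.
Proof.
rewrite integral_nneseries//.
have -> : 2%:E = (\sum_(k <oo) (2 / (2 ^ (k + 1))%:R)%:E)%E :> \bar R.
  have := @cvg_geometric_eseries_half R 2 0; rewrite expr0 divr1.
  by move=> /cvg_lim <-//.
apply: lee_nneseries => k _; first by move=> _; exact: integral_ge0.
under eq_integral do rewrite powRM// EFinM.
rewrite ge0_integralZl_EFin//; last 2 first.
- by move=> a _; rewrite lee_fin powR_ge0.
- exact: measurable_cut_dist_powR.
apply: (@le_trans _ _ (((2 ^+ k) `^ p)%:E * ((4 ^- k) `^ p)%:E)%E).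
  rewrite lee_wpmul2l ?lee_fin ?powR_ge0//; exact: integral_le_dp.
rewrite -EFinM lee_fin -powRM ?invr_ge0 ?exprn_ge0//.
have -> : 2 ^+ k / 4 ^+ k = 2 ^- k :> R.
  have -> : 4 = 2 * 2 :> R by ring.
  by rewrite exprMn invfM mulrA mulfV ?mul1r// expf_eq0 (gt_eqF (ltr0n _ 2)) andbF.
have -> : 2 / (2 ^ (k + 1))%:R = 2 ^- k :> R.
  by rewrite natrX addn1 exprS invfM mulrA mulfV ?mul1r.
have h01 : 0 < (2 ^- k : R) <= 1.
  by rewrite half_pow_gt0 invf_le1 ?exprn_gt0// exprn_ege1// ler1n.
by apply: le_trans (ger_powR h01 p1) _; rewrite powRr1// ltW// half_pow_gt0.
Qed.

Lemma ae_weighted_steps_lty : {ae mu, forall a, weighted_steps a < +oo}%E.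
Proof.
have := @integrable_ae _ _ _ mu setT measurableT weighted_steps.
move=> /(_ _)/wrap[].
  apply/integrableP; split; first exact: measurable_weighted_steps.
  under eq_integral do rewrite gee0_abs ?weighted_steps_ge0//.
  by apply: le_lt_trans integral_weighted_steps_le _; rewrite ltry.
by apply: ae_mono => a /(_ I); rewrite ge0_fin_numE// weighted_steps_ge0.
Qed.

(** Each term is at most the whole sum, so its [p]-th root bounds [2 ^+ k * step k a]. Taking [C]
    strictly larger ensures [0 < C]. *)
Lemma good_level_weighted a (C : R) : 0 < a <= 1 ->
  (weighted_steps a < +oo)%E -> fine (weighted_steps a) `^ p^-1 < C ->
  good_level u_ C a.
Proof.
move=> a01 afin aC; split=> //; first by apply: le_lt_trans aC; exact: powR_ge0.
move=> k; rewrite -ler_pdivrMr ?half_pow_gt0// invrK mulrC.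
apply: le_trans (ltW aC).
have pn0 : p != 0 by rewrite gt_eqF.
have x0 : 0 <= 2 ^+ k * step k a by rewrite mulr_ge0// exprn_ge0.
rewrite [leLHS](_ : _ = ((2 ^+ k * step k a) `^ p) `^ p^-1); last first.
  by rewrite -powRrM mulfV// powRr1.
apply: ge0_ler_powR; rewrite ?nnegrE ?powR_ge0 ?invr_ge0 ?(ltW p0)//.
  by rewrite fine_ge0// weighted_steps_ge0.
rewrite -lee_fin fineK ?ge0_fin_numE ?weighted_steps_ge0//.
(* The partial sum stops at [k.+1], so that the term [k] is its last one. *)
have := @nneseries_lim_ge R
  (fun k => ((((2 ^+ k * step k a) `^ p)%R)%:E)) xpredT 0 k.+1.
move=> /(_ (fun n _ _ => term_ge0 n a)); apply: le_trans.
rewrite big_nat_recr//=; apply: leeDr; apply: sume_ge0 => i _.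
exact: term_ge0.
Qed.

Let D : set R := [set a | exists C, good_level u_ C a].

Definition dp_limit := level_sup D (limit_cut u_).

Let D01 a : D a -> 0 < a <= 1. Proof. by move=> [C []]. Qed.

Let dense_D (a b : R) : 0 <= a -> a < b -> b <= 1 -> exists2 c, a < c < b & D c.
Proof.
move=> a0 ab b1; have [c acb cfin] := ae_itv_oo ab ae_weighted_steps_lty.
exists c => //; exists (fine (weighted_steps c) `^ p^-1 + 1).
have /andP[ac cb] := acb; apply: good_level_weighted => //.
  by rewrite (le_lt_trans a0)//= ltW// (lt_le_trans cb).
by rewrite ltrDl.
Qed.

Lemma bounded_cut_dp_limit : bounded_cut_fuzzy dp_limit.
Proof.
apply: bounded_cut_level_sup => //.
- exact: limit_cut_le.
- exact: closed_limit_cut.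
- by move=> *; exact: limit_cut_convex.
- by move=> a [C]; exact: limit_cut_nonempty.
- by move=> a [C]; exact: bounded_limit_cut.
Qed.

(** The exceptional levels are those of infinite weight and the countably many jumps. Elsewhere the
    cut of the limit is [limit_cut], so the distance is at most [4 * C * 2 ^- n] for every [C] above
    the [p]-th root [s], hence also for [s]. *)
Lemma ae_cut_dist_dp_limit n : {ae mu, forall a,
  cut_dist (u_ n) dp_limit a `^ p <=
    (4 * 2 ^- n) `^ p * fine (weighted_steps a)}.
Proof.
have cJ := countable_jump_levels D (limit_cut u_).
have [N [mN N0 HN]] := ae_weighted_steps_lty.
exists (N `|` jump_levels D (limit_cut u_)); split.
- by apply: measurableU => //; exact: countable_measurable.
- apply: null_set_setU => //; first exact: countable_measurable.
  exact: countable_lebesgue_measure0.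
move=> a /= Ha; apply: contrapT => /not_orP[nN nJ]; apply: Ha.
have afin : (weighted_steps a < +oo)%E.
  by apply: contrapT => nfin; apply: nN; exact: HN.
have s0 : 0 <= fine (weighted_steps a) by rewrite fine_ge0// weighted_steps_ge0.
have h0 := @half_pow_gt0 R n.
have [a01|a01] := boolP (0 < a <= 1); last first.
  by rewrite /cut_dist (negPf a01) powR0 ?gt_eqF// mulr_ge0// powR_ge0.
set s := fine (weighted_steps a) `^ p^-1.
have -> : fine (weighted_steps a) = s `^ p.
  by rewrite /s -powRrM mulVf ?gt_eqF// powRr1.
rewrite -powRM ?powR_ge0 ?mulr_ge0 ?(ltW h0)//.
rewrite ge0_ler_powR ?nnegrE ?(ltW p0) ?cut_dist_ge0//.
  by rewrite !mulr_ge0 ?powR_ge0 ?(ltW h0).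
apply/ler_addgt0Pr => e e0.
(* With [C = s + e / 4] the excess is [e * 2 ^- n], at most [e]. *)
have sC : s < s + e / 4 by rewrite ltrDl divr_gt0.
have gC := good_level_weighted a01 afin sC.
have Da : D a by exists (s + e / 4).
have cutE : forall x, (a <= dp_limit x) = (limit_cut u_ a x) :> Prop.
  move=> x; have := level_sup_cutE D01 (@limit_cut_le _ _ u_)
    (@closed_limit_cut _ _ u_) Da nJ.
  by move=> /(congr1 (fun A => A x)).
have C0 : 0 < (s + e / 4) * 2 ^- n.
  by rewrite mulr_gt0// (le_lt_trans _ sC)// powR_ge0.
have le_e : 4 * (s + e / 4) * 2 ^- n <= 4 * 2 ^- n * s + e.
  have : 2 ^- n <= 1 :> R by rewrite invf_le1 ?exprn_gt0// exprn_ege1// ler1n.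
  by nra.
apply: le_trans le_e; apply/cut_dist_leP => //; first exact: bounded_cut_dp_limit.
split=> [x d ax d0|y d]; last rewrite cutE => Ky d0.
  have [y Ky xy] := near_limit_cut bu gC ax; exists y; first by rewrite cutE.
  by apply: le_lt_trans xy _; rewrite ltrDl.
have [x ax yx] := limit_cut_near bu n gC Ky d0; exists x => //.
by rewrite eucl_distC; lra.
Qed.

(** The integral is at most [2] times [(4 * 2 ^- n) ^ p]; as [2 <= 2 ^ p], the factor [2] moves
    inside the power and gives [8]. *)
Lemma dp_limit_le n : (dp p (u_ n) dp_limit <= (8 * 2 ^- n)%:E)%E.
Proof.
have h0 := @half_pow_gt0 R n.
have bl := bounded_cut_dp_limit.
apply: dp_le => //.
apply: (@le_trans _ _ (\int[mu]_a (((4 * 2 ^- n) `^ p)%:E * weighted_steps a))%E).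
  apply: ae_ge0_le_integral => //.
  - by move=> a _; rewrite lee_fin powR_ge0.
  - exact: measurable_cut_dist_powR.
  - by move=> a _; rewrite mule_ge0 ?weighted_steps_ge0// lee_fin powR_ge0.
  - apply: measurable_funeM; exact: measurable_weighted_steps.
  - have := ae_weighted_steps_lty; have := ae_cut_dist_dp_limit n.
    move=> [N [mN N0 HN]] [N' [mN' N0' HN']]; exists (N `|` N'); split.
    + exact: measurableU.
    + exact: null_set_setU.
    move=> a /= Ha; apply: contrapT => /not_orP[nN nN']; apply: Ha => _.
    have afin : (weighted_steps a < +oo)%E.
      by apply: contrapT => nfin; apply: nN'; exact: HN'.
    rewrite -(fineK (_ : weighted_steps a \is a fin_num)); last first.
      by rewrite ge0_fin_numE// weighted_steps_ge0.
    by rewrite -EFinM lee_fin; apply: contrapT => nle; apply: nN; exact: HN.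
rewrite ge0_integralZl_EFin ?powR_ge0//; last 2 first.
- by move=> a _; exact: weighted_steps_ge0.
- exact: measurable_weighted_steps.
apply: (@le_trans _ _ (((4 * 2 ^- n) `^ p)%:E * 2%:E)%E).
  by rewrite lee_wpmul2l ?lee_fin ?powR_ge0// integral_weighted_steps_le.
have -> : 8 * 2 ^- n = (4 * 2 ^- n) * 2 :> R by ring.
rewrite -EFinM lee_fin [leRHS]powRM ?mulr_ge0 ?(ltW h0)// ler_wpM2l ?powR_ge0//.
by rewrite -[leLHS](@powRr1 R 2)// ler_powR// ler1n.
Qed.

End Completeness.

(** * The metric space of [L^p] fuzzy numbers: completeness and density *)

Section LpFuzzyMetric.
Context {R : realType} {m : nat} (p : R) (p1 : 1 <= p).

(** The type carries a proof of [1 <= p], under which [dp] satisfies the triangle inequality. *)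
Definition Lp_fuzzy_space of 1 <= p : Type :=
  {u : 'rV[R]_m -> R | Lp_fuzzy_number p u}.

Local Notation E := (Lp_fuzzy_space p1).

Let p0 : 0 < p. Proof. exact: lt_le_trans p1. Qed.

Definition Lp_fuzzy_val (x : E) : 'rV[R]_m -> R := sval x.

Definition Lp_fuzzy_dist (x y : E) : R :=
  fine (dp p (Lp_fuzzy_val x) (Lp_fuzzy_val y)).

Lemma Lp_fuzzy_bounded_cut (x : E) : bounded_cut_fuzzy (Lp_fuzzy_val x).
Proof. by have [] := (Lp_fuzzy_numberP _ p0).1 (svalP x). Qed.

Lemma Lp_fuzzy_distE (x y : E) :
  (Lp_fuzzy_dist x y)%:E = dp p (Lp_fuzzy_val x) (Lp_fuzzy_val y).
Proof. rewrite fineK//; apply: dp_fin_num => //; exact: svalP. Qed.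

Lemma Lp_fuzzy_distxx (x : E) : Lp_fuzzy_dist x x = 0.
Proof.
by rewrite /Lp_fuzzy_dist dpxx ?gt_eqF//; exact: Lp_fuzzy_bounded_cut.
Qed.

Lemma Lp_fuzzy_dist_eq0 (x y : E) : Lp_fuzzy_dist x y = 0 -> x = y.
Proof.
move=> xy0; have := Lp_fuzzy_distE x y; rewrite xy0 => /esym.
move=> /(dp_eq0 p0 (Lp_fuzzy_bounded_cut x) (Lp_fuzzy_bounded_cut y)).
by case: x y {xy0} => [u Lu] [v Lv]; exact: eq_exist.
Qed.

Lemma Lp_fuzzy_distC (x y : E) : Lp_fuzzy_dist x y = Lp_fuzzy_dist y x.
Proof. by rewrite /Lp_fuzzy_dist dpC. Qed.

Lemma Lp_fuzzy_dist_triangle (y x z : E) :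
  Lp_fuzzy_dist x z <= Lp_fuzzy_dist x y + Lp_fuzzy_dist y z.
Proof.
have := dp_triangle p1 (Lp_fuzzy_bounded_cut x) (Lp_fuzzy_bounded_cut y)
  (Lp_fuzzy_bounded_cut z).
by rewrite -!Lp_fuzzy_distE -EFinD lee_fin.
Qed.

HB.instance Definition _ := gen_eqMixin E.
HB.instance Definition _ := gen_choiceMixin E.
HB.instance Definition _ := isMetric.Build R E Lp_fuzzy_distxx Lp_fuzzy_dist_eq0
  Lp_fuzzy_distC Lp_fuzzy_dist_triangle.

(** A Cauchy filter contains balls of radius [4 ^- k / 2]; their centres form a rapidly Cauchy
    sequence, whose limit is also the limit of the filter. *)
Lemma Lp_fuzzy_complete (F : set_system E) : ProperFilter F -> cauchy F ->
  exists l : E, F --> l.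
Proof.
move=> FF /cauchyP Fc.
have quarter k : 4 ^- k / 2 + 4 ^- k.+1 / 2 <= 4 ^- k :> R.
  have h : 0 < 4 ^- k :> R by rewrite invr_gt0 exprn_gt0.
  by rewrite exprSr invfM; lra.
have /choice[x xF] : forall k, exists x : E, F (ball x (4 ^- k / 2)).
  by move=> k; apply: Fc; rewrite divr_gt0// invr_gt0 exprn_gt0.
have bx n := Lp_fuzzy_bounded_cut (x n).
have dx k : (dp p (Lp_fuzzy_val (x k)) (Lp_fuzzy_val (x k.+1)) <= (4 ^- k)%:E)%E.
  (* Two members of a proper filter meet, so consecutive centres have a common neighbour [z]. *)
  have [z []] := filter_ex (filterI (xF k) (xF k.+1)).
  rewrite !ballEmdist/= => xz; rewrite metric_sym => zx.
  rewrite -Lp_fuzzy_distE lee_fin.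
  apply: le_trans (metric_triangle (x k) z (x k.+1)) _.
  exact: le_trans (lerD (ltW xz) (ltW zx)) (quarter k).
have Ll : Lp_fuzzy_number p (dp_limit (fun n => Lp_fuzzy_val (x n))).
  apply/Lp_fuzzy_numberP => //.
  have bl := bounded_cut_dp_limit p1 bx dx; split; first exact: bl.
  apply: le_lt_trans (dp_triangle p1 bl (bx 0%N) bounded_cut_crisp0) _.
  apply: lte_add_pinfty.
    by rewrite dpC; apply: le_lt_trans (dp_limit_le p1 bx dx 0) _; rewrite ltry.
  by have [] := (Lp_fuzzy_numberP _ p0).1 (svalP (x 0%N)).
pose l : E := exist _ _ Ll.
exists l; apply/metricType_numDomainType.fcvgrPdist_lt => e e0.
(* With [2 ^- n < e / 16], the first summand [8 * 2 ^- n] is below [e / 2] and the radius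
   [4 ^- n / 2] below [e / 32]. *)
have e16 : 0 < e / 16 by rewrite divr_gt0.
have [n /(_ n (leqnn n)) ne] := half_pow_lt e16.
have small : 8 * 2 ^- n + 4 ^- n / 2 < e.
  have le42 : 4 ^- n <= 2 ^- n :> R.
    by rewrite lef_pV2 ?posrE ?exprn_gt0// lerXn2r ?nnegrE// ler_nat.
  by lra.
apply: filterS (xF n) => y; rewrite ballEmdist/= => xy.
apply: le_lt_trans (metric_triangle l (x n) y) _.
have ln : mdist l (x n) <= 8 * 2 ^- n.
  have := dp_limit_le p1 bx dx n; rewrite -[dp _ _ _](Lp_fuzzy_distE (x n) l).
  by rewrite lee_fin metric_sym.
exact: le_lt_trans (lerD ln (ltW xy)) small.
Qed.

Lemma Lp_fuzzy_dense : dense (Lp_fuzzy_val @^-1` @fuzzy_number R m).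
Proof.
move=> O [x Ox] Oo; have /nbhs_ballP[e /= e0 eO] : nbhs x O by exact: open_nbhs_nbhs.
have [v fv xv] := dp_truncate_lt p0 (svalP x) e0.
pose y : E := exist _ v (fuzzy_number_Lp p0 fv).
exists y; split; last exact: fv.
apply: eO; rewrite ballEmdist/= -lte_fin.
change ((Lp_fuzzy_dist x y)%:E < e%:E)%E.
by rewrite Lp_fuzzy_distE; exact: xv.
Qed.

End LpFuzzyMetric.

Theorem theorem6p9 (R : realType) (m : nat) (p : R)
    (hm : (1 <= m)%N) (hp : 1 <= p) :
  is_completion (dp (m := m) p) (Lp_fuzzy_number p) (@fuzzy_number R m).
Proof.
have p0 : 0 < p by exact: lt_le_trans hp.
split; first by move=> u; exact: fuzzy_number_Lp.
exists (Lp_fuzzy_space (m := m) hp), (@Lp_fuzzy_val R m p hp); split.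
- split; first by move=> x _; exact: svalP.
    by move=> x y _ _; case: x y => [u Lu] [v Lv]; exact: eq_exist.
  by move=> u Lu; exists (exist _ u Lu).
- exact: Lp_fuzzy_distE.
- exact: Lp_fuzzy_complete.
- exact: Lp_fuzzy_dense.
Qed.
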